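(* Let $U\subseteq\mathbb{R}^n$ be a domain and $f:U\to Cl_n$ a left Clifford holomorphic function. Let $D(y,R)$ be a closed ball centered at $y$ of radius $R>0$ contained in $U$. Then \[f(y)=\frac{1}{R\,\omega_n}\int_{D(y,R)}\frac{f(x)}{\|x-y\|^{n-1}}\,dx^n,\] where $\omega_n$ is the surface area of the unit sphere in $\mathbb{R}^n$ and $dx^n$ is Lebesgue measure.
   Context: $Cl_n$ is the real Clifford algebra generated by an orthonormal basis $e_1,\ldots,e_n$ of $\mathbb{R}^n$ with $e_ie_j+e_je_i=-2\delta_{ij}$. A $C^1$ function $f:U\to Cl_n$ is left Clifford holomorphic if $\sum_{j=1}^n e_j\frac{\partial f}{\partial x_j}=0$ on $U$. *)

(* Defs.v *)
From HB Require Import structures.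
From mathcomp Require Import all_boot all_order all_algebra.
From mathcomp Require Import all_classical all_reals all_analysis.
Set Implicit Arguments. Unset Strict Implicit. Unset Printing Implicit Defensive.
Import Order.TTheory GRing.Theory Num.Theory.
Import numFieldNormedType.Exports.
Local Open Scope classical_set_scope.
Local Open Scope ring_scope.

(* Lebesgue measure on R^n, built as the n-fold product measure of the       *)
(* Lebesgue measure on R:  R^n ~ R * (R * ( ... * unit)).                    *)
Record msp (R : realType) := MSp {
  msp_d : measure_display;
  msp_T : measurableType msp_d;
  msp_m : {sigma_finite_measure set msp_T -> \bar R} }.

(* The library's sigma-finite instance for [m1 \x m2] is shadowed by the   *)
(* (sub)probability one, so we re-declare it on a transparent alias.         *)
Section pmeas.
Local Open Scope ereal_scope.
Context d1 d2 (T1 : measurableType d1) (T2 : measurableType d2) (R : realType).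
Variable m1 : {sigma_finite_measure set T1 -> \bar R}.
Variable m2 : {sigma_finite_measure set T2 -> \bar R}.

Definition pmeas : set (T1 * T2) -> \bar R := (m1 \x m2)%E.
HB.instance Definition _ := Measure.on pmeas.

Lemma pmeas_sigma_finite : sigma_finite setT pmeas.
Proof.
have /sigma_finiteP[F [TF ndF Foo]] := sigma_finiteT m1.
have /sigma_finiteP[G [TG ndG Goo]] := sigma_finiteT m2.
exists (fun n => F n `*` G n).
 rewrite -setXTT TF TG predeqE => -[x y]; split.
    move=> [/= [n _ Fnx] [k _ Gky]]; exists (maxn n k) => //; split.
    - by move: x Fnx; exact/subsetPset/ndF/leq_maxl.
    - by move: y Gky; exact/subsetPset/ndG/leq_maxr.
  by move=> [n _ []/= ? ?]; split; exists n.
move=> k; have [? ?] := Foo k; have [? ?] := Goo k.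
split; first exact: measurableX.
by rewrite /pmeas product_measure1E// lte_mul_pinfty// ge0_fin_numE.
Qed.

HB.instance Definition _ := Measure_isSigmaFinite.Build _ _ _ pmeas
  pmeas_sigma_finite.
End pmeas.

Fixpoint lebRn (R : realType) (n : nat) : msp R :=
  match n with
  | 0 => @MSp R _ unit (@dirac _ unit tt R)
  | m.+1 => @MSp R _ (measurableTypeR R * msp_T (lebRn R m))%type
              (@pmeas _ _ (measurableTypeR R) (msp_T (lebRn R m)) R
                 (@lebesgue_measure R) (msp_m (lebRn R m)))
  end.

Fixpoint coords (R : realType) (n : nat) : msp_T (lebRn R n) -> nat -> R :=
  match n return msp_T (lebRn R n) -> nat -> R with
  | 0 => fun _ _ => 0
  | m.+1 => fun p k => match k with
                       | 0 => p.1
                       | k'.+1 => @coords R m p.2 k'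
                       end
  end.

Definition to_rV (R : realType) (n : nat) (p : msp_T (lebRn R n)) : 'rV[R]_n :=
  \row_(i < n) coords p i.

Definition lebesgue_int_Rn (R : realType) (n : nat) (S : set 'rV[R]_n)
    (g : 'rV[R]_n -> R) : \bar R :=
  (\int[msp_m (lebRn R n)]_(p in @to_rV R n @^-1` S) (g (@to_rV R n p))%:E)%E.

Definition lebesgue_Rn (R : realType) (n : nat) (S : set 'rV[R]_n) : \bar R :=
  msp_m (lebRn R n) (@to_rV R n @^-1` S).

Definition enorm (R : realType) (n : nat) (v : 'rV[R]_n) : R :=
  Num.sqrt (\sum_(i < n) v ord0 i ^+ 2).

Definition cball_E (R : realType) (n : nat) (y : 'rV[R]_n) (r : R) : set 'rV[R]_n :=
  [set x | enorm (x - y) <= r].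

(* surface area of the unit sphere S^{n-1}: omega_n = n * vol(unit ball) *)
Definition omega (R : realType) (n : nat) : R :=
  n%:R * fine (lebesgue_Rn (cball_E (0 : 'rV[R]_n) 1)).

Definition domain (R : realType) (n : nat) (U : set 'rV[R]_n) : Prop :=
  open U /\ connected U /\ U !=set0.

(* The real Clifford algebra Cl_n: elements are real coordinate families     *)
(* a = sum_A a_A e_A over subsets A of {0,..,n-1} (e_A = e_{a1}...e_{ak}     *)
(* for a1 < ... < ak).  With e_i e_j + e_j e_i = -2 delta_ij one has         *)
(*   e_A e_B = (-1)^{#{(a,b) in A x B | a > b}} (-1)^{|A cap B|} e_{A Δ B}.  *)
Definition Cl (R : realType) (n : nat) := {set 'I_n} -> R.

Definition symdiff (n : nat) (A B : {set 'I_n}) : {set 'I_n} := (A :\: B) :|: (B :\: A).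

Definition cl_sign (R : realType) (n : nat) (A B : {set 'I_n}) : R :=
  (-1) ^+ (#|[set ab : 'I_n * 'I_n | [&& ab.1 \in A, ab.2 \in B & (ab.2 < ab.1)%N]]| + #|A :&: B|)%N.

Definition clmul (R : realType) (n : nat) (a b : Cl R n) : Cl R n :=
  fun C => \sum_(A : {set 'I_n}) \sum_(B : {set 'I_n})
     (if symdiff A B == C then cl_sign R A B * a A * b B else 0).

Definition cl_e (R : realType) (n : nat) (j : 'I_n) : Cl R n :=
  fun A => if A == [set j]%SET then 1 else 0.

Definition cl_sum (R : realType) (n : nat) (F : 'I_n -> Cl R n) : Cl R n :=
  fun C => \sum_(j < n) F j C.

Definition unit_vec (R : realType) (n : nat) (j : 'I_n) : 'rV[R]_n := delta_mx ord0 j.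

Definition partial (R : realType) (n : nat) (f : 'rV[R]_n -> Cl R n) (j : 'I_n)
    (x : 'rV[R]_n) : Cl R n :=
  fun A => ('D_(unit_vec R j) (fun z => f z A)) x.

Definition C1_on (R : realType) (n : nat) (U : set 'rV[R]_n) (f : 'rV[R]_n -> Cl R n) : Prop :=
  forall (A : {set 'I_n}) (j : 'I_n),
    (forall x, U x -> derivable (fun z => f z A) x (unit_vec R j)) /\
    {within U, continuous (fun x => partial f j x A)}.

Definition left_clifford_holomorphic (R : realType) (n : nat) (U : set 'rV[R]_n)
    (f : 'rV[R]_n -> Cl R n) : Prop :=
  C1_on U f /\
  forall x, U x -> cl_sum (fun j => clmul (cl_e R j) (partial f j x)) = (fun _ => 0).

(* Main.v *)
(* Multiplying the equation [sum_j e_j d_j f = 0] on the left by the vector [x] expresses the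
   Euler derivative [sum_i x_i d_i f] as a combination of the rotation derivatives
   [x_i d_j f - x_j d_i f], [i <> j], since [e_i e_j = - e_j e_i].  Lebesgue measure is
   rotation invariant, so for the radial weight [w(x) = |x|^(1-n)] on the unit ball the integral
   of each rotation derivative of [f(y + t x)] against [w] vanishes.  Hence
   [Phi(t) = int_(|x| <= 1) f(y + t x) w(x) dx] has derivative [0], and [Phi(r) = Phi(0)].
   The left side is the integral of the theorem up to the substitution [x -> y + r x], and the
   right side is [f(y) int w].  Rotation invariance follows from Tonelli's theorem, because a
   plane rotation is a product of three shears; the value [int w = n vol] follows from
   homogeneity. *)
Require Import Defs.
From HB Require Import structures.
From mathcomp Require Import all_boot all_order all_algebra.
From mathcomp Require Import all_classical all_reals all_analysis.
From mathcomp Require Import measurable_realfun lra ring.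
Set Implicit Arguments. Unset Strict Implicit. Unset Printing Implicit Defensive.
Import Order.TTheory GRing.Theory Num.Theory.
Import numFieldNormedType.Exports.
Local Open Scope classical_set_scope.
Local Open Scope ring_scope.

(** For [Phi] to be constant the weight need only be radial and integrable; the exponent [1 - n]
    matters for the value of its integral, which must be [omega]. No surface measure, divergence
    theorem or polar coordinates occur: the geometry of the measure reduces to Tonelli on the
    iterated product and to scaling. Beyond [e_i] squaring to a nonzero scalar, Clifford
    multiplication enters only through the antisymmetry in [i] and [j] of the sign of [e_i e_j]: the
    weighted integrals of [x_i d_j f] and [x_j d_i f] coincide, so the sum over pairs equals its own
    negative. Three obstacles shape the rest. [C1_on] speaks of partial derivatives only, so
    continuity and the chain rule are rebuilt from the mean value theorem. [f] is arbitrary outside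
    [U], so integrands are cut off to a closed ball before measurability is discussed, and [Phi] is
    differentiated only for [0 < t < r]. For [n > 1] the weight is unbounded near the centre, so its
    integral must be shown finite before homogeneity can determine it. *)

Section affine1.
Context {R : realType}.
Local Open Scope ereal_scope.

(** * Affine substitution on the real line *)

Lemma measurable_affine (b c : R) :
  measurable_fun [set: measurableTypeR R] (fun x : measurableTypeR R => (b + c * x)%R : measurableTypeR R).
Proof.
by apply: (@measurable_funD _ _ R) => //; exact: (@measurable_funM _ _ R).
Qed.

(** The image of Lebesgue measure under [x -> b + c x], multiplied by [c], gives each interval []s,
    t]] its length, so uniqueness of Lebesgue measure applies. *)
Lemma lebesgue_measure_affine (b c : R) (c0 : (0 < c)%R) (A : set (measurableTypeR R)) :
  measurable A ->
  lebesgue_measure A = c%:E * lebesgue_measure [set x : R | A (b + c * x)%R].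
Proof.
move=> mA.
pose phi := (fun x : measurableTypeR R => (b + c * x)%R : measurableTypeR R).
have mphi : measurable_fun setT phi by exact: measurable_affine.
pose phiM : {mfun measurableTypeR R >-> measurableTypeR R} :=
  HB.pack phi (isMeasurableFun.Build _ _ _ _ _ mphi).
apply: (@lebesgue_measure_unique R
  (mscale (NngNum (ltW c0)) (pushforward lebesgue_measure phiM))) => // X [[s t] _ <-].
rewrite /= /mscale /= /pushforward.
rewrite [X in _ = _ * lebesgue_measure X](_ : _ = `](s - b) / c, (t - b) / c]%classic)%R; last first.
  apply/seteqP; split => x /=; rewrite !in_itv/= /phi;
  by rewrite ltr_pdivrMr// ler_pdivlMr// ltrBlDl lerBrDl (mulrC x).
rewrite !lebesgue_measure_itv/= !lte_fin ltr_pM2r ?invr_gt0// ltrD2r.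
case: ifPn => _; last by rewrite mule0.
rewrite -EFinM; congr EFin; rewrite -mulrBl mulrC divfK ?gt_eqF//.
by rewrite opprB addrA subrK.
Qed.

Lemma ge0_integral_affine (b c : R) (g : measurableTypeR R -> \bar R) :
  (0 < c)%R -> measurable_fun setT g -> (forall x, 0 <= g x) ->
  \int[lebesgue_measure]_x g x =
  c%:E * \int[lebesgue_measure]_x g (b + c * x)%R.
Proof.
move=> c0 mg g0.
pose phi := (fun x : measurableTypeR R => (b + c * x)%R : measurableTypeR R).
have mphi : measurable_fun setT phi by exact: measurable_affine.
pose phiM : {mfun measurableTypeR R >-> measurableTypeR R} :=
  HB.pack phi (isMeasurableFun.Build _ _ _ _ _ mphi).
rewrite -(@ge0_integral_pushforward _ _ _ _ _ phi mphi lebesgue_measure setT g)//.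
rewrite -(@ge0_integral_mscale _ _ _ (pushforward lebesgue_measure phiM) setT measurableT
  (NngNum (ltW c0)) g)//.
apply: eq_measure_integral => A mA _.
exact: lebesgue_measure_affine.
Qed.
End affine1.

(** * Row vectors, Tonelli and affine substitution in dimension [n] *)

Section lebRn_theory.
Context {R : realType}.
Local Notation T n := (msp_T (lebRn R n)).
Local Notation mu n := (msp_m (lebRn R n)).

(** Row-vector counterpart of the pair [(a, q)] in [T n.+1]; inductions on the dimension go through
    it. *)
Definition consv n (a : R) (v : 'rV[R]_n) : 'rV[R]_n.+1 :=
  \row_(i < n.+1) oapp (v ord0) a (unlift ord0 i).

Lemma consv0 n a (v : 'rV[R]_n) : consv a v ord0 ord0 = a.
Proof. by rewrite mxE unlift_none. Qed.

Lemma consvS n a (v : 'rV[R]_n) j : consv a v ord0 (lift ord0 j) = v ord0 j.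
Proof. by rewrite mxE liftK. Qed.

Lemma consvP n (v w : 'rV[R]_n.+1) :
  v ord0 ord0 = w ord0 ord0 ->
  (forall j, v ord0 (lift ord0 j) = w ord0 (lift ord0 j)) -> v = w.
Proof.
by move=> h0 h; apply/rowP => i; case: (unliftP ord0 i) => [j|] ->.
Qed.

Lemma to_rV_consv n (a : R) (q : T n) :
  to_rV ((a, q) : T n.+1) = consv a (to_rV q).
Proof.
by apply: consvP => [|j]; rewrite ?consv0 ?consvS !mxE.
Qed.

Fixpoint of_rV n : 'rV[R]_n -> T n :=
  match n return 'rV[R]_n -> T n with
  | 0 => fun _ => tt
  | m.+1 => fun v => (v ord0 ord0, of_rV (\row_(j < m) v ord0 (lift ord0 j)))
  end.

Lemma of_rVK n (v : 'rV[R]_n) : to_rV (of_rV v) = v.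
Proof.
elim: n v => [|n IH] v; first by apply/rowP => -[].
rewrite /= to_rV_consv IH.
by apply: consvP => [|j]; rewrite ?consv0 ?consvS// mxE.
Qed.

Lemma measurable_coord n (i : 'I_n) :
  measurable_fun [set: T n] (fun p => to_rV p ord0 i).
Proof.
elim: n i => [[]//|n IH i].
rewrite (_ : (fun _ => _) = (fun p : T n.+1 => consv p.1 (to_rV p.2) ord0 i)); last first.
  by apply/funext => -[a q]; rewrite to_rV_consv.
case: (unliftP ord0 i) => [j|] ->.
  under eq_fun do rewrite consvS.
  by apply: (measurableT_comp (IH j)); exact: measurable_snd.
under eq_fun do rewrite consv0.
exact: measurable_fst.
Qed.

Lemma measurable_of_rV d (X : measurableType d) n (h : X -> 'rV[R]_n) :
  (forall i, measurable_fun setT (fun x => h x ord0 i)) ->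
  measurable_fun setT (fun x => of_rV (h x)).
Proof.
elim: n h => [|n IH] h mh; first exact: measurable_cst.
apply: measurable_fun_pair => /=; first exact: mh.
by apply: IH => i; under eq_fun do rewrite mxE; exact: mh.
Qed.

(** Measurability in a row vector is read on the iterated product space, where the measure lives. *)
Definition Borel d (Y : measurableType d) n (g : 'rV[R]_n -> Y) :=
  measurable_fun [set: T n] (fun p => g (to_rV p)).

(** Since [of_rV] is a measurable section of [to_rV], a map into row vectors only has to be checked
    coordinate by coordinate. *)
Lemma Borel_comp d (X : measurableType d) d' (Y : measurableType d') n
    (g : 'rV[R]_n -> Y) (h : X -> 'rV[R]_n) :
  Borel g -> (forall i, measurable_fun setT (fun x => h x ord0 i)) ->
  measurable_fun setT (fun x => g (h x)).
Proof.
move=> mg mh; under eq_fun do rewrite -(of_rVK (h _)).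
by apply: (measurableT_comp mg); exact: measurable_of_rV.
Qed.

Local Open Scope ereal_scope.

Definition intRn n (g : 'rV[R]_n -> \bar R) := \int[mu n]_p g (to_rV p).

Lemma Borel_consv n d (Y : measurableType d) (g : 'rV[R]_n.+1 -> Y) a :
  Borel g -> Borel (fun v => g (consv a v)).
Proof.
move=> mg; apply: (Borel_comp mg) => i.
case: (unliftP ord0 i) => [j|] ->.
  under eq_fun do rewrite consvS; exact: measurable_coord.
under eq_fun do rewrite consv0; exact: measurable_cst.
Qed.

Lemma intRnS n (g : 'rV[R]_n.+1 -> \bar R) : Borel g -> (forall v, 0 <= g v) ->
  intRn g = \int[lebesgue_measure]_a intRn (fun v => g (consv a v)).
Proof.
move=> mg g0; rewrite /intRn.
rewrite [LHS](@fubini_tonelli1 _ _ _ _ _ lebesgue_measure (mu n)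
  (fun p => g (to_rV (p : T n.+1))) mg (fun=> g0 _)).
apply: eq_integral => a _; rewrite /fubini_F.
by apply: eq_integral => q _; rewrite to_rV_consv.
Qed.

Lemma intRnS2 n (g : 'rV[R]_n.+1 -> \bar R) : Borel g -> (forall v, 0 <= g v) ->
  intRn g = intRn (fun v => \int[lebesgue_measure]_a g (consv a v)).
Proof.
move=> mg g0; rewrite /intRn.
rewrite [LHS](@fubini_tonelli2 _ _ _ _ _ lebesgue_measure (mu n)
  (fun p => g (to_rV (p : T n.+1))) mg (fun=> g0 _)).
apply: eq_integral => q _; rewrite /fubini_G.
by apply: eq_integral => a _; rewrite to_rV_consv.
Qed.

Lemma measurable_intRn_consv n (g : 'rV[R]_n.+1 -> \bar R) :
  Borel g -> (forall v, 0 <= g v) ->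
  measurable_fun [set: measurableTypeR R] (fun a => intRn (fun v => g (consv a v))).
Proof.
move=> mg g0; rewrite /intRn.
have := (@measurable_fun_fubini_tonelli_F _ _ (measurableTypeR R) _ _ (mu n)
  (fun p => g (to_rV (p : T n.+1))) mg).
rewrite /fubini_F; under eq_fun do under eq_integral do rewrite to_rV_consv.
by apply.
Qed.

Lemma intRn_ge0 n (g : 'rV[R]_n -> \bar R) : (forall v, 0 <= g v) -> 0 <= intRn g.
Proof. by move=> g0; apply: integral_ge0. Qed.

(** Tonelli splits off the first coordinate, which yields one factor [c]; the remaining coordinates
    yield the other factors by induction. *)
Lemma intRn_affine n (y : 'rV[R]_n) (c : R) (g : 'rV[R]_n -> \bar R) :
  (0 < c)%R -> Borel g -> (forall v, 0 <= g v) ->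
  intRn g = (c ^+ n)%:E * intRn (fun v => g (y + c *: v)%R).
Proof.
move=> c0; elim: n y g => [|n IH] y g mg g0.
  rewrite expr0 mul1e; congr intRn; apply/funext => v; congr g.
  by apply/rowP => -[].
have mg' : Borel (fun v => g (y + c *: v)%R).
  apply: (Borel_comp mg) => i; under eq_fun do rewrite !mxE.
  apply: measurable_funD => //; apply: measurable_funM => //.
  by have := @measurable_coord n.+1 i; under eq_fun do rewrite mxE.
rewrite (intRnS mg g0) [in RHS](intRnS mg' (fun=> g0 _)).
pose y' := (\row_j y ord0 (lift ord0 j))%R : 'rV[R]_n.
have E a v : (y + c *: consv a v = consv (y ord0 ord0 + c * a) (y' + c *: v))%R.
  by apply: consvP => [|j]; rewrite mxE [in LHS]mxE ?consv0 ?consvS// !mxE ?liftK.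
under [in RHS]eq_integral do under eq_fun do rewrite E.
have G0 a : 0 <= intRn (fun v => g (consv a v)) by exact: intRn_ge0.
rewrite (ge0_integral_affine (y ord0 ord0) c0 (measurable_intRn_consv mg g0) G0).
rewrite exprS EFinM -muleA; congr (_ * _).
rewrite -ge0_integralZl//; last 3 first.
- have := measurable_intRn_consv mg'.
  by move=> /(_ (fun=> g0 _)); under eq_fun do under eq_fun do rewrite E.
- by move=> a _; exact: intRn_ge0.
- by rewrite lee_fin exprn_ge0// ltW.
apply: eq_integral => a _; apply: (IH y' (fun v => g (consv (y ord0 ord0 + c * a) v))) => //.
exact: Borel_consv.
Qed.
End lebRn_theory.

(** * Shears and plane rotations preserve the integral *)

Section rotation.
Context {R : realType}.
Local Open Scope ereal_scope.

Lemma intRn_translate n (y : 'rV[R]_n) (g : 'rV[R]_n -> \bar R) :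
  Borel g -> (forall v, 0 <= g v) -> intRn (fun v => g (v + y)%R) = intRn g.
Proof.
move=> mg g0; rewrite [RHS](@intRn_affine _ _ y 1%R)// expr1n mul1e.
by congr intRn; apply/funext => v; rewrite scale1r addrC.
Qed.

Definition shear n (i j : 'I_n) (c : R) (v : 'rV[R]_n) : 'rV[R]_n :=
  (v + (c * v ord0 j) *: unit_vec R i)%R.

Lemma Borel_shear n (i j : 'I_n) c (g : 'rV[R]_n -> \bar R) :
  Borel g -> Borel (fun v => g (shear i j c v)).
Proof.
move=> mg; apply: (Borel_comp mg) => k.
under eq_fun do rewrite mxE [X in (_ + X)%R]mxE.
apply: measurable_funD; first exact: measurable_coord.
apply: measurable_funM => //; apply: measurable_funM => //.
exact: measurable_coord.
Qed.

Lemma unit_vecS n (i : 'I_n) : unit_vec R (lift ord0 i) = consv 0%R (unit_vec R i).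
Proof. by apply: consvP => [|j]; rewrite ?consv0 ?consvS !mxE. Qed.

Lemma unit_vec0 n : unit_vec R (@ord0 n) = consv 1%R 0%R.
Proof. by apply: consvP => [|j]; rewrite ?consv0 ?consvS !mxE. Qed.

Lemma consvD n a b (v w : 'rV[R]_n) : (consv a v + consv b w = consv (a + b) (v + w))%R.
Proof. by apply: consvP => [|j]; rewrite ?consv0 ?consvS mxE ?consv0 ?consvS// mxE. Qed.

Lemma consvZ n a b (v : 'rV[R]_n) : (a *: consv b v = consv (a * b) (a *: v))%R.
Proof. by apply: consvP => [|j]; rewrite ?consv0 ?consvS mxE ?consv0 ?consvS// mxE. Qed.

(** With the other coordinates frozen, a shear translates coordinate [i] by an amount that does not
    depend on it. The order of integration is chosen so that coordinate [i] is integrated while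
    coordinate [j] is fixed. *)
Lemma intRn_shear n (i j : 'I_n) c (g : 'rV[R]_n -> \bar R) :
  i != j -> Borel g -> (forall v, 0 <= g v) ->
  intRn (fun v => g (shear i j c v)) = intRn g.
Proof.
elim: n i j g => [[]//|n IH] i j g.
move=> + mg g0; have mgs := Borel_shear i j c mg.
case: (unliftP ord0 i) mgs => [i'|] ->; case: (unliftP ord0 j) => [j'|] -> mgs //.
- rewrite (inj_eq (@lift_inj _ _)) => ij.
  rewrite (intRnS mgs (fun=> g0 _)) [RHS](intRnS mg g0); apply: eq_integral => a _.
  rewrite -(IH i' j' (fun v => g (consv a v)))//; last exact: Borel_consv.
  congr intRn; apply/funext => v.
  by rewrite /shear unit_vecS consvZ mulr0 consvD addr0 consvS.
(* Here [j] is the first coordinate: for fixed [a] the tail is translated by [c * a] along [i']. *)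
- move=> _; rewrite (intRnS mgs (fun=> g0 _)) [RHS](intRnS mg g0); apply: eq_integral => a _.
  rewrite -[RHS](intRn_translate ((c * a) *: unit_vec R i')%R (g := fun v => g (consv a v)))//; last exact: Borel_consv.
  congr intRn; apply/funext => v.
  by rewrite /shear unit_vecS consvZ mulr0 consvD addr0 consv0.
(* Here [i] is the first coordinate, so it becomes the inner variable, translated by
   [c * v ord0 j']. *)
- move=> _; rewrite (intRnS2 mgs (fun=> g0 _)) [RHS](intRnS2 mg g0).
  congr intRn; apply/funext => v.
  rewrite [RHS](ge0_integral_affine (c * v ord0 j')%R ltr01)//; last first.
    apply: (Borel_comp mg) => k; case: (unliftP ord0 k) => [k'|] ->.
      under eq_fun do rewrite consvS; exact: measurable_cst.
    under eq_fun do rewrite consv0; exact: measurable_id.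
  rewrite mul1e; apply: eq_integral => a _.
  by rewrite /shear unit_vec0 consvZ mulr1 scaler0 consvD addr0 consvS mul1r addrC.
Qed.

(** For [i != j], the rotation by [t] in the plane of coordinates [i] and [j], written as the
    identity plus a correction so that no case distinction on coordinates is needed. *)
Definition rotv n (i j : 'I_n) (t : R) (v : 'rV[R]_n) : 'rV[R]_n :=
  (v + ((cos t - 1) * v ord0 i - sin t * v ord0 j) *: unit_vec R i
     + (sin t * v ord0 i + (cos t - 1) * v ord0 j) *: unit_vec R j)%R.

(** The classical three-shear factorisation. The condition on [cos (t / 2)] makes [tan (t / 2)]
    meaningful; it holds for the small angles used later. *)
Lemma rotvE n (i j : 'I_n) (t : R) v : i != j -> cos (t / 2) != 0%R ->
  rotv i j t v = shear i j (- tan (t / 2)) (shear j i (sin t) (shear i j (- tan (t / 2)) v)).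
Proof.
move=> ij c0.
have ji : j != i by rewrite eq_sym.
have t2 : t = (t / 2 *+ 2)%R by rewrite -mulr_natr divfK.
have ct : (cos t = 1 - tan (t / 2) * sin t)%R.
  rewrite {1 3}t2 cos_mulr2n sin_mulr2n cos2sin2 /tan; field.
  by rewrite c0.
have st : (sin t = 2 * tan (t / 2) - tan (t / 2) ^+ 2 * sin t)%R.
  rewrite {1 4}t2 sin_mulr2n /tan.
  transitivity (2 * sin (t / 2) / cos (t / 2) * (1 - sin (t / 2) ^+ 2))%R.
    by rewrite -cos2sin2; field; rewrite c0.
  by field; rewrite c0.
apply/rowP => k.
rewrite /shear /rotv !mxE !eqxx /= ?(negbTE ij) ?(negbTE ji) /= ct.
set x := (k == i)%:R%R; set y := (k == j)%:R%R.
apply/eqP; rewrite -subr_eq0; apply/eqP.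
(* With [cos t] eliminated by [ct], the two sides differ by a multiple of the identity [st]. *)
transitivity (x * v ord0 j * (2 * tan (t / 2) - tan (t / 2) ^+ 2 * sin t - sin t))%R.
  by ring.
by rewrite -st subrr mulr0.
Qed.

Lemma intRn_rot n (i j : 'I_n) t (g : 'rV[R]_n -> \bar R) :
  i != j -> cos (t / 2) != 0%R -> Borel g -> (forall v, 0 <= g v) ->
  intRn (fun v => g (rotv i j t v)) = intRn g.
Proof.
move=> ij c0 mg g0; have ji : j != i by rewrite eq_sym.
under eq_fun do rewrite rotvE//.
rewrite (intRn_shear _ ij
  (g := fun w => g (shear i j (- tan (t / 2)) (shear j i (sin t) w))))//; last first.
  by apply: (@Borel_shear _ j i _ (fun w => g (shear i j (- tan (t / 2)) w))); exact: Borel_shear.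
rewrite (intRn_shear _ ji (g := fun w => g (shear i j (- tan (t / 2)) w)))//; last exact: Borel_shear.
exact: intRn_shear.
Qed.

Lemma intRn_posneg n (g : 'rV[R]_n -> \bar R) :
  intRn g = intRn (fun v => maxe (g v) 0) - intRn (fun v => maxe (- g v) 0).
Proof.
rewrite /intRn integralE; congr (_ - _).
  by apply: eq_integral => p _; rewrite funeposE.
by apply: eq_integral => p _; rewrite funenegE.
Qed.

Lemma Borel_pos n (g : 'rV[R]_n -> \bar R) : Borel g -> Borel (fun v => maxe (g v) 0).
Proof. by move=> mg; exact: measurable_maxe. Qed.

Lemma Borel_neg n (g : 'rV[R]_n -> \bar R) : Borel g -> Borel (fun v => maxe (- g v) 0).
Proof. by move=> mg; apply: measurable_maxe => //; apply: measurableT_comp. Qed.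

Lemma intRn_rot_signed n (i j : 'I_n) t (g : 'rV[R]_n -> \bar R) :
  i != j -> cos (t / 2) != 0%R -> Borel g ->
  intRn (fun v => g (rotv i j t v)) = intRn g.
Proof.
move=> ij c0 mg; rewrite intRn_posneg [RHS]intRn_posneg; congr (_ - _).
  by rewrite (intRn_rot ij c0 (g := fun v => maxe (g v) 0))//;
    [exact: Borel_pos|move=> v; rewrite le_max lexx orbT].
by rewrite (intRn_rot ij c0 (g := fun v => maxe (- g v) 0))//;
  [exact: Borel_neg|move=> v; rewrite le_max lexx orbT].
Qed.

Lemma intRn_affine_signed n (y : 'rV[R]_n) (c : R) (g : 'rV[R]_n -> \bar R) :
  (0 < c)%R -> Borel g ->
  intRn g = (c ^+ n)%:E * intRn (fun v => g (y + c *: v)%R).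
Proof.
move=> c0 mg; rewrite intRn_posneg [in RHS]intRn_posneg.
have cn : (0 < c ^+ n)%R by rewrite exprn_gt0.
rewrite (@intRn_affine _ _ y c (fun v => maxe (g v) 0))//;
  [|exact: Borel_pos|by move=> v; rewrite le_max lexx orbT].
rewrite (@intRn_affine _ _ y c (fun v => maxe (- g v) 0))//;
  [|exact: Borel_neg|by move=> v; rewrite le_max lexx orbT].
(* The factor [c ^+ n] is finite and positive, hence distributes over the extended difference in
   each finite or infinite case. *)
move: (intRn _) (intRn _) => [a||] [b||];
  rewrite -?EFinB -?EFinM ?mulrBr//= ?gt0_muley ?gt0_muleNy ?lte_fin//.
Qed.

Lemma enorm_rot n (i j : 'I_n) t (v : 'rV[R]_n) : i != j -> enorm (rotv i j t v) = enorm v.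
Proof.
move=> ij; have ji : j != i by rewrite eq_sym.
rewrite /enorm; congr Num.sqrt.
rewrite (bigD1 i)//= (bigD1 j)//= [RHS](bigD1 i)//= [in RHS](bigD1 j)//= !addrA.
congr (_ + _)%R; last first.
  apply: eq_bigr => k /andP[ki kj].
  by rewrite /rotv !mxE (negbTE ki) (negbTE kj) /= !mulr0 !addr0.
rewrite /rotv !mxE !eqxx (negbTE ij) (negbTE ji) /= !mulr0 !mulr1 !addr0.
transitivity ((cos t ^+ 2 + sin t ^+ 2) * (v ord0 i ^+ 2 + v ord0 j ^+ 2))%R; first by ring.
by rewrite cos2Dsin2 mul1r.
Qed.
End rotation.

(** * Differential calculus from continuous partial derivatives *)

Section calculus.
Context {R : realType}.

Lemma cvg_norm_le (V W : normedModType R) (q : V -> W) (x : W) :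
  (forall v, `|x - q v| <= `|v|) -> q v @[v --> (0 : V)] --> x.
Proof.
move=> qx; apply/cvgrPdist_lt => e e0; near=> v.
by apply: (le_lt_trans (qx v)); near: v; exact: nbhs0_lt.
Unshelve. all: by end_near. Qed.

Lemma near0_norm_lt (V : normedModType R) (P : V -> Prop) d : 0 < d ->
  (forall v, `|v| < d -> P v) -> \forall v \near (0 : V), P v.
Proof.
by move=> d0 dP; near=> v; apply: dP; near: v; exact: nbhs0_lt.
Unshelve. all: by end_near. Qed.

Lemma continuous_increment (V : normedModType R) (h g : V -> R) (x : V) :
  g v @[v --> (0 : V)] --> 0 -> (\forall v \near (0 : V), h (x + v) - h x = g v) ->
  {for x, continuous h}.
Proof.
move=> g0 hg; rewrite continuous_shift; apply/cvgrPdist_lt => e e0.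
move/cvgrPdist_lt : g0 => /(_ _ e0) g0; near=> v.
have E : h (x + v) - h x = g v by near: v.
rewrite /= add0r distrC (addrC v) E -normrN -sub0r.
by near: v.
Unshelve. all: by end_near. Qed.

Lemma ler_coord_norm n (v : 'rV[R]_n) i : `|v ord0 i| <= `|v|.
Proof.
rewrite [leRHS]mx_normrE.
exact: (le_bigmax _ (fun ij : 'I_1 * 'I_n => `|v ij.1 ij.2|) (ord0, i)).
Qed.

Lemma rV_norm_le n (v : 'rV[R]_n) c : 0 <= c -> (forall i, `|v ord0 i| <= c) -> `|v| <= c.
Proof.
move=> c0 vc; rewrite [leLHS]mx_normrE; apply: bigmax_le => // -[k i] _ /=.
by rewrite (ord1 k); exact: vc.
Qed.

Lemma is_derive_line n (h : 'rV[R]_n -> R) (p e : 'rV[R]_n) (s : R) :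
  derivable h (p + s *: e) e ->
  is_derive s 1 (fun s => h (p + s *: e)) ('D_e h (p + s *: e)).
Proof.
have E : (fun u : R => u^-1 *: (h (p + (u *: 1 + s) *: e) - h (p + s *: e))) =
         (fun u : R => u^-1 *: (h (u *: e + (p + s *: e)) - h (p + s *: e))).
  apply/funext => u; congr (_ *: (h _ - _)).
  by rewrite scalerDl /GRing.scale /= mulr1 addrCA.
move=> dh; apply: DeriveDef; last by rewrite /derive E.
by rewrite /derivable E.
Qed.

Lemma MVT_line n (h : 'rV[R]_n -> R) (p e : 'rV[R]_n) (c : R) :
  (forall s : R, `|s| <= `|c| -> derivable h (p + s *: e) e) ->
  exists2 s : R, `|s| <= `|c| & h (p + c *: e) - h p = c * 'D_e h (p + s *: e).
Proof.
move=> dh; pose phi s := h (p + s *: e).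
have dphi (s : R) : `|s| <= `|c| -> is_derive s 1 phi ('D_e h (p + s *: e)).
  by move=> /dh; exact: is_derive_line.
have cphi (a b : R) : (forall s : R, s \in `[a, b] -> `|s| <= `|c|) -> {within `[a, b], continuous phi}.
  move=> ab; apply: derivable_within_continuous => s sab.
  by have [] := dphi _ (ab _ sab).
have phi0 : phi 0 = h p by rewrite /phi scale0r addr0.
have [c0|c0] := leP 0 c.
  have H (s : R) : s \in `[0, c] -> `|s| <= `|c|.
    by rewrite in_itv/= => /andP[s0 sc]; rewrite !ger0_norm.
  have [|s sc] := @MVT_segment R phi (fun s => 'D_e h (p + s *: e)) _ _ c0 _ (cphi _ _ H).
    by move=> s sc; apply: dphi; apply: H; exact: subset_itv_oo_cc.
  rewrite phi0 subr0 mulrC => E; exists s => //; exact: H.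
have H (s : R) : s \in `[c, 0] -> `|s| <= `|c|.
  by rewrite in_itv/= => /andP[s0 sc]; rewrite !ler0_norm ?lerN2// ltW.
have [|s sc] := @MVT_segment R phi (fun s => 'D_e h (p + s *: e)) _ _ (ltW c0) _ (cphi _ _ H).
  by move=> s sc; apply: dphi; apply: H; exact: subset_itv_oo_cc.
rewrite phi0 sub0r mulrN => E; exists s; first exact: H.
by rewrite -opprB E opprK mulrC.
Qed.

Definition C1 n (U : set 'rV[R]_n) (h : 'rV[R]_n -> R) :=
  forall j, (forall x, U x -> derivable h x (unit_vec R j)) /\
    {within U, continuous (fun x => 'D_(unit_vec R j) h x)}.

(* Caratheodory form of differentiability, the slopes coming from the mean value theorem applied
   one coordinate at a time. *)
Lemma C1_slope n (U : set 'rV[R]_n) (h : 'rV[R]_n -> R) x : open U -> C1 U h -> U x ->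
  exists2 a : 'I_n -> 'rV[R]_n -> R,
    (forall k, a k v @[v --> (0 : 'rV[R]_n)] --> 'D_(unit_vec R k) h x) &
    \forall v \near (0 : 'rV[R]_n), h (x + v) - h x = \sum_(k < n) v ord0 k * a k v.
Proof.
move=> oU hU Ux.
have [d /= d0 dU] : exists2 d : R, 0 < d & forall z, `|x - z| < d -> U z.
  by have /nbhs_ballP[d /= d0 dU] := oU _ Ux; exists d => // z; rewrite -ball_normE in dU; apply: dU.
(* [p k v] has the first [k] coordinates of [x + v] and the others of [x], so [p 0 v = x] and
   [p n v = x + v]. *)
pose p (k : nat) (v : 'rV[R]_n) := x + \row_i (if (i < k)%N then v ord0 i else 0).
(* The intermediate point is requested for every [v], with default [x] for long [v], so that choice
   gives a function defined everywhere and tending to [x]. *)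
have H (kv : 'I_n * 'rV[R]_n) : exists q, `|x - q| <= `|kv.2| /\
    (`|kv.2| < d -> h (p kv.1.+1 kv.2) - h (p kv.1 kv.2) = kv.2 ord0 kv.1 * 'D_(unit_vec R kv.1) h q).
  case: kv => k v /=.
  have [vd|vd] := ltP `|v| d; last by exists x; rewrite subrr normr0.
  have Hq (s : R) : `|s| <= `|v ord0 k| -> `|x - (p k v + s *: unit_vec R k)| <= `|v|.
    move=> sv; rewrite /p opprD opprD addrA addrA subrr sub0r -opprD normrN.
    apply: rV_norm_le => // i; rewrite !mxE /=.
    have [->|ik] := eqVneq i k.
      by rewrite ltnn add0r mulr1 (le_trans sv)// ler_coord_norm.
    rewrite mulr0 addr0; case: ifP => _; first exact: ler_coord_norm.
    by rewrite normr0.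
  have [|s sv E] := @MVT_line _ h (p k v) (unit_vec R k) (v ord0 k).
    by move=> s sv; apply: (hU k).1; apply: dU; exact: le_lt_trans (Hq _ sv) vd.
  exists (p k v + s *: unit_vec R k); split; first exact: Hq.
  move=> _; rewrite -E; congr (h _ - _).
  rewrite /p -addrA; congr (_ + _); apply/rowP => i; rewrite !mxE /=.
  have [->|ik] := eqVneq i k; first by rewrite ltnS leqnn ltnn add0r mulr1.
  by rewrite mulr0 addr0 ltnS leq_eqVlt (negbTE (_ : (i : nat) != k))//=.
have [q qP] := choice H.
exists (fun k v => 'D_(unit_vec R k) h (q (k, v))).
  move=> k.
  have ck : {for x, continuous ('D_(unit_vec R k) h)}.
    by have := (hU k).2; rewrite continuous_open_subspace// => /(_ x); apply; rewrite inE.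
  have qx := @cvg_norm_le 'rV[R]_n 'rV[R]_n (fun v => q (k, v)) x (fun v => (qP (k, v)).1).
  exact: (continuous_cvg _ ck qx).
apply: (near0_norm_lt d0) => v vd.
under eq_bigr do rewrite -(qP (_, _)).2//=.
rewrite -(big_mkord xpredT (fun k => h (p k.+1 v) - h (p k v))) telescope_sumr//.
congr (h _ - h _); rewrite /p.
  by congr (_ + _); apply/rowP => i; rewrite mxE ltn_ord.
by rewrite -[LHS]addr0; congr (_ + _); apply/rowP => i; rewrite !mxE ltn0.
Qed.

Lemma cvg_sumr (I : finType) (X : Type) (F : set_system X) {FF : Filter F}
    (g : I -> X -> R) (l : I -> R) :
  (forall i, g i x @[x --> F] --> l i) ->
  \sum_i g i x @[x --> F] --> \sum_i l i.
Proof. by move=> gl; apply: cvg_big => //; exact: add_continuous. Qed.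

Lemma cvg0_sumM (V : normedModType R) (I : finType) (c a : I -> V -> R) (l : I -> R) :
  (forall k, c k v @[v --> (0 : V)] --> 0) ->
  (forall k, a k v @[v --> (0 : V)] --> l k) ->
  \sum_k c k v * a k v @[v --> (0 : V)] --> 0.
Proof.
move=> c0 al; rewrite [X in _ --> X](_ : 0 = \sum_k 0 * l k); last first.
  by rewrite big1// => k _; rewrite mul0r.
by apply: cvg_sumr => k; exact: cvgM.
Qed.

(** [C1] does not include continuity of [h]; the increment tends to 0 because its slopes converge
    while the coordinates of [v] vanish. *)
Lemma C1_continuous n (U : set 'rV[R]_n) (h : 'rV[R]_n -> R) x : open U -> C1 U h -> U x ->
  {for x, continuous h}.
Proof.
move=> oU hU Ux; have [a ca ha] := C1_slope oU hU Ux.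
apply: continuous_increment ha.
apply: (@cvg0_sumM 'rV[R]_n _ (fun k v => v ord0 k) a _ _ ca) => k.
by have := @coord_continuous R 1 n ord0 k (0 : 'rV[R]_n); rewrite /continuous_at mxE.
Qed.

Lemma cvg_increment (V : normedModType R) (g : R -> V) (s : R) : {for s, continuous g} ->
  g (u *: 1 + s) - g s @[u --> (0 : R)^'] --> (0 : V).
Proof.
move=> cg.
apply: cvg_within_filter.
suff us : (u *: 1 + s : R) @[u --> (0 : R)] --> s.
  have gs : g (u *: 1 + s) @[u --> (0 : R)] --> g s by exact: (continuous_cvg _ cg us).
  exact/subr_cvg0.
apply/subr_cvg0; under eq_fun do rewrite addrK /GRing.scale /= mulr1.
exact: cvg_id.
Qed.

Lemma cvg_comp0 (V : normedModType R) (X : Type) (F : set_system X) (w : X -> V)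
    (a : V -> R) (l : R) :
  w x @[x --> F] --> (0 : V) -> a v @[v --> (0 : V)] --> l -> a (w x) @[x --> F] --> l.
Proof. exact: cvg_comp. Qed.

(** Substituting the increment of the curve into the slope formula turns the difference quotient
    into a sum of coordinate quotients times slopes, and each factor converges. *)
Lemma C1_chain n (U : set 'rV[R]_n) (h : 'rV[R]_n -> R) (g : R -> 'rV[R]_n) (s : R)
    (dg : 'I_n -> R) : open U -> C1 U h -> U (g s) ->
  (forall k, is_derive s 1 (fun t => g t ord0 k) (dg k)) ->
  is_derive s 1 (fun t => h (g t)) (\sum_(k < n) dg k * 'D_(unit_vec R k) h (g s)).
Proof.
move=> oU hU Ux dgP; have [a ca ha] := C1_slope oU hU Ux.
have cg : {for s, continuous g}.
  apply: differentiable_continuous; apply/derivable1_diffP.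
  by apply/derivable_mxP => i j; rewrite (ord1 i); have [] := dgP j.
pose w (u : R) := g (u *: 1 + s) - g s.
have w0 : w u @[u --> 0^'] --> (0 : 'rV[R]_n).
  exact: (@cvg_increment 'rV[R]_n).
have hw : \forall u \near (0 : R)^', h (g s + w u) - h (g s) = \sum_(k < n) w u ord0 k * a k (w u).
  exact: (w0 _ ha).
have H : u^-1 *: (h (g (u *: 1 + s)) - h (g s)) @[u --> 0^'] -->
    \sum_(k < n) dg k * 'D_(unit_vec R k) h (g s).
  have : \sum_(k < n) ((u^-1 *: (g (u *: 1 + s) ord0 k - g s ord0 k)) * a k (w u)) @[u --> 0^'] -->
    \sum_(k < n) dg k * 'D_(unit_vec R k) h (g s).
    apply: cvg_sumr => k; apply: cvgM.
      by have [? <-] := dgP k.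
    exact: (@cvg_comp0 'rV[R]_n _ _ w (a k) _ w0 (ca k)).
  apply: cvg_trans; apply: near_eq_cvg; near=> u.
  have -> : h (g (u *: 1 + s)) - h (g s) = \sum_(k < n) w u ord0 k * a k (w u).
    have <- : h (g s + w u) - h (g s) = \sum_(k < n) w u ord0 k * a k (w u) by near: u.
    by rewrite /w [g s + _]addrC subrK.
  rewrite scaler_sumr; apply: eq_bigr => k _; rewrite /w !mxE /GRing.scale /=.
  by rewrite mulrA.
apply: DeriveDef; first by apply/cvg_ex; eexists; exact: H.
exact: cvg_lim.
Unshelve. all: by end_near. Qed.
End calculus.

(** * Signs of the Clifford product and the Euler derivative *)

Section clifford.
Context {R : realType} {n : nat}.
Implicit Types A B C : {set 'I_n}.

Lemma symdiffK A B : symdiff A (symdiff A B) = B.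
Proof. by apply/setP => x; rewrite !inE; case: (x \in A); case: (x \in B). Qed.

Lemma in_symdiff1 (j : 'I_n) C x : (x \in symdiff [set j]%SET C) = (x == j) (+) (x \in C).
Proof. by rewrite !inE; case: (x == j); case: (x \in C). Qed.

Lemma symdiff1C (i j : 'I_n) C :
  symdiff [set i]%SET (symdiff [set j]%SET C) = symdiff [set j]%SET (symdiff [set i]%SET C).
Proof. by apply/setP => x; rewrite !in_symdiff1 addbCA. Qed.

(** The sign of [e_j e_B] for the only [B] with [e_j e_B] proportional to [e_C]; left multiplication
    by [e_j] is thus a signed permutation of components. *)
Definition esign (j : 'I_n) C : R := cl_sign R [set j]%SET (symdiff [set j]%SET C).

Lemma clmul_e (j : 'I_n) (a : Cl R n) C :
  clmul (cl_e R j) a C = esign j C * a (symdiff [set j]%SET C).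
Proof.
rewrite /clmul (bigD1 [set j]%SET)//= [X in _ + X]big1 ?addr0; last first.
  move=> A Aj; rewrite big1// => B _; case: ifP => // _.
  by rewrite /cl_e (negbTE Aj) mulr0 mul0r.
rewrite (bigD1 (symdiff [set j]%SET C))//= symdiffK eqxx big1 ?addr0; last first.
  move=> B Bj; case: ifPn => // /eqP E; move: Bj; rewrite -E symdiffK eqxx//.
by rewrite /cl_e eqxx mulr1.
Qed.

(** Parity of the number of transpositions that move [e_j] past the smaller generators in [e_C]. *)
Definition below (j : 'I_n) C := odd #|[set b in C | (b < j)%N]|.

Lemma odd_symdiff1 (j : 'I_n) C : odd #|symdiff [set j]%SET C| = ~~ odd #|C|.
Proof.
have [jC|jC] := boolP (j \in C).
  rewrite (cardsD1 j C) jC add1n /= negbK; congr (odd #|pred_of_set _|).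
  apply/setP => x; rewrite in_symdiff1 !inE.
  by have [->|] := eqVneq x j; rewrite ?jC.
rewrite -[RHS]/(odd #|C|.+1) -(add1n #|C|) -[1%N]/(true : nat) -jC -cardsU1.
congr (odd #|pred_of_set _|); apply/setP => x; rewrite in_symdiff1 !inE.
by have [->|] := eqVneq x j; rewrite ?(negbTE jC).
Qed.

Lemma below_symdiff1 (i j : 'I_n) C : below j (symdiff [set i]%SET C) = below j C (+) (i < j)%N.
Proof.
rewrite /below; have [ij|ij] := boolP (i < j)%N.
  rewrite addbT -(odd_symdiff1 i); congr (odd #|pred_of_set _|); apply/setP => x.
  rewrite inE !in_symdiff1 inE.
  by have [->|_] := eqVneq x i; rewrite ?ij ?andbT.
rewrite addbF; congr (odd #|pred_of_set _|); apply/setP => x.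
rewrite inE in_symdiff1 inE.
by have [->|_] := eqVneq x i; rewrite ?(negbTE ij) ?andbF.
Qed.

(** Besides the transpositions, [e_j e_j = -1] contributes a sign when [j] already lies in [B], that
    is, when [j] is not in [C]. *)
Lemma esignE (j : 'I_n) C : esign j C = (-1) ^+ (below j C (+) (j \notin C)).
Proof.
rewrite /esign /cl_sign; set B := symdiff _ _.
have -> : #|[set ab : 'I_n * 'I_n | [&& ab.1 \in [set j]%SET, ab.2 \in B & (ab.2 < ab.1)%N]]|
    = #|[set b in B | (b < j)%N]|.
  rewrite -(card_imset (mem [set b in B | (b < j)%N]) (_ : injective (pair j))); last by move=> x y [].
  apply: eq_card => -[a b]; apply/idP/imsetP => [/set_mem /= |[x]].
    by rewrite inE => /and3P[/eqP -> bB bj]; exists b; rewrite // inE bB.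
  by rewrite inE => /andP[xB xj] [-> ->]; apply/mem_set => /=; rewrite inE eqxx xB.
have -> : #|[set j]%SET :&: B| = (j \notin C).
  have -> : (j \notin C) = (j \in B) by rewrite in_symdiff1 eqxx.
  have [jB|jB] := boolP (j \in B).
    by rewrite (finset.setIidPl _) ?cards1// finset.sub1set.
  by apply/eqP; rewrite cards_eq0 finset.setI_eq0 disjoints1.
by rewrite -signr_odd oddD -/(below j B) below_symdiff1 ltnn addbF oddb.
Qed.

(* Coefficient of [e_i e_j] acting on the component indexed by [A]. *)
Definition esign2 (i j : 'I_n) A : R :=
  esign i (symdiff [set i]%SET A) * esign j (symdiff [set i]%SET A).

Lemma esign2ii i A : esign2 i i A = 1.
Proof. by rewrite /esign2 esignE -signr_addb addbb. Qed.

(** Swapping [i] and [j] flips three parities: membership of [i], membership of [j], and the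
    comparison, since exactly one of [i < j] and [j < i] holds. *)
Lemma esign2_anti i j A : i != j -> esign2 j i A = - esign2 i j A.
Proof.
move=> ij; have ji : j != i by rewrite eq_sym.
rewrite /esign2 !esignE -!signr_addb -signrN.
congr (_ ^+ _); congr nat_of_bool.
rewrite !below_symdiff1 !in_symdiff1 !eqxx (negbTE ij) (negbTE ji) !ltnn !addbF.
have -> : (j < i)%N = ~~ (i < j)%N.
  by rewrite -leqNgt ltn_neqAle -[(_ == _ :> nat)]/(j == i) ji.
by case: (below j A); case: (below i A); case: (i \in A); case: (j \in A); case: (i < j)%N.
Qed.

Lemma clifford_euler (U : set 'rV[R]_n) (f : 'rV[R]_n -> Cl R n) z (x : 'rV[R]_n) A :
  left_clifford_holomorphic U f -> U z ->
  \sum_(i < n) x ord0 i * partial f i z A =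
  - \sum_(i < n) \sum_(j < n | j != i)
     esign2 i j A * (x ord0 i * partial f j z (symdiff [set j]%SET (symdiff [set i]%SET A))).
Proof.
move=> [_ hol] Uz; apply/eqP; rewrite -subr_eq0 opprK -big_split /=; apply/eqP.
rewrite big1// => i _.
have := congr1 (fun g => g (symdiff [set i]%SET A)) (hol z Uz); rewrite /cl_sum /=.
under eq_bigr do rewrite clmul_e.
(* This factor is the negative of [esign i A], so in effect the equation is multiplied by
   [- x_i e_i], which makes the diagonal coefficient [+1]. *)
move=> /(congr1 (fun t => x ord0 i * esign i (symdiff [set i]%SET A) * t)).
rewrite mulr0 mulr_sumr (bigD1 i)//= => E; rewrite -[RHS]E; congr (_ + _).
  by rewrite symdiffK mulrA -[X in _ = X * _]mulrA -/(esign2 i i A) esign2ii mulr1.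
by apply: eq_bigr => j ji; rewrite /esign2; ring.
Qed.
End clifford.

Lemma continuous_sumr (R : realType) (V : topologicalType) (I : finType) (g : I -> V -> R) (x : V) :
  (forall i, {for x, continuous (g i)}) -> {for x, continuous (fun z => \sum_i g i z)}.
Proof. by move=> cg; apply: cvg_sumr => i; exact: cg. Qed.

(** * Euclidean norm, balls and measurability of open sets *)

Section euclid.
Context {R : realType} {n : nat}.
Implicit Types (v x y : 'rV[R]_n).

Lemma enorm_ge0 v : 0 <= enorm v.
Proof. exact: sqrtr_ge0. Qed.

Lemma enormZ c v : enorm (c *: v) = `|c| * enorm v.
Proof.
rewrite /enorm; under eq_bigr do rewrite mxE exprMn.
by rewrite -mulr_sumr sqrtrM ?sqr_ge0// sqrtr_sqr.
Qed.

Lemma ler_coord_enorm v i : `|v ord0 i| <= enorm v.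
Proof.
rewrite /enorm -sqrtr_sqr ler_wsqrtr// (bigD1 i)//= lerDl.
by apply: sumr_ge0 => k _; exact: sqr_ge0.
Qed.

Lemma norm_le_enorm v : `|v| <= enorm v.
Proof. by apply: rV_norm_le => [|i]; [exact: enorm_ge0|exact: ler_coord_enorm]. Qed.

(** The crude factor [n], in place of its square root, suffices to fit a cube into the unit ball. *)
Lemma enorm_le v c : 0 <= c -> (forall i, `|v ord0 i| <= c) -> enorm v <= n%:R * c.
Proof.
move=> c0 vc; rewrite /enorm -[leRHS]ger0_norm ?mulr_ge0// -sqrtr_sqr ler_wsqrtr//.
have H : \sum_(i < n) v ord0 i ^+ 2 <= \sum_(i < n) c ^+ 2.
  by apply: ler_sum => i _; rewrite -[v ord0 i ^+ 2]real_normK ?num_real// lerXn2r ?nnegrE.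
apply: (le_trans H); rewrite sumr_const card_ord -[c ^+ 2 *+ n]mulr_natl exprMn ler_wpM2r ?sqr_ge0//.
rewrite -natrX ler_nat; case: (n) => // m; exact: leq_pmulr.
Qed.

Lemma continuous_enormB y : continuous (fun x => enorm (x - y)).
Proof.
move=> x; rewrite /enorm.
apply: (@continuous_comp _ _ _ (fun x : 'rV[R]_n => \sum_(i < n) (x - y) ord0 i ^+ 2)
  (@Num.sqrt R)); last exact: sqrt_continuous.
apply: (@continuous_sumr R 'rV[R]_n) => i.
rewrite (_ : (fun z : 'rV[R]_n => _) = (fun z : 'rV[R]_n => (z ord0 i - y ord0 i) ^+ 2)); last first.
  by apply/funext => z; rewrite !mxE.
have ci : {for x, continuous (fun z : 'rV[R]_n => z ord0 i - y ord0 i)}.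
  apply: continuousB; last exact: cst_continuous.
  exact: coord_continuous.
exact: (continuous_comp ci (@exprn_continuous _ _ _)).
Qed.

Lemma compact_cball y r : compact (cball_E y r).
Proof.
apply: bounded_closed_compact.
  exists (`|y| + r); split; first exact: num_real.
  move=> M yM x /= xr; apply: le_trans (ltW yM).
  rewrite -[x](subrK y) addrC (le_trans (ler_normD _ _))// lerD2l.
  exact: le_trans (norm_le_enorm _) xr.
apply: (@preimage_closed _ _ (fun x => enorm (x - y)) [set z | z <= r]).
  by move=> x _; exact: continuous_enormB.
exact: closed_le.
Qed.

Lemma mem_cball y r p : (p \in @to_rV R n @^-1` cball_E y r) = (enorm (to_rV p - y) <= r).
Proof. by apply/idP/idP => [/set_mem|h] //; apply/mem_set. Qed.

Lemma measurable_coord_affine y t i :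
  measurable_fun [set: msp_T (lebRn R n)] (fun p => (y + t *: to_rV p) ord0 i).
Proof.
under eq_fun do rewrite mxE [X in _ + X]mxE.
by apply: measurable_funD => //; apply: measurable_funM => //; exact: measurable_coord.
Qed.

(** An open set is the union of the rational boxes it contains; there are countably many, each a
    finite intersection of coordinate conditions. *)
Lemma measurable_open_rV (V : set 'rV[R]_n) : open V -> measurable (@to_rV R n @^-1` V).
Proof.
move=> oV.
pose box (ck : 'rV[rat]_n * nat) : set 'rV[R]_n :=
  \bigcap_(i in [set: 'I_n]) [set x | `|x ord0 i - ratr (ck.1 ord0 i)| < ck.2.+1%:R^-1].
have mbox ck : measurable (@to_rV R n @^-1` box ck).
  rewrite /box preimage_bigcap; apply: fin_bigcap_measurable => // i _.
  rewrite -[X in measurable X]setTI.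
  have -> : (to_rV (n:=n) @^-1` [set x | `|x ord0 i - ratr (ck.1 ord0 i)| < ck.2.+1%:R^-1])
    = (fun p => to_rV p ord0 i) @^-1` [set z : R | `|z - ratr (ck.1 ord0 i)| < ck.2.+1%:R^-1] by [].
  apply: (measurable_coord i) => //.
  rewrite (_ : [set z | _] = ball (ratr (ck.1 ord0 i) : R) (ck.2.+1%:R^-1)); first exact: measurable_ball.
  by rewrite -ball_normE; apply/seteqP; split => z /=; rewrite distrC.
have -> : V = \bigcup_(ck in [set: 'rV[rat]_n * nat]) (if `[< box ck `<=` V >] then box ck else set0).
  apply/seteqP; split => [x Vx|x [ck _]]; last by case: ifPn => // /asboolP; apply.
  have [e /= e0 eV] : exists2 e : R, 0 < e & forall z, `|x - z| < e -> V z.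
    by have /nbhs_ballP[d /= d0 dU] := oV _ Vx; exists d => // z; rewrite -ball_normE in dU; apply: dU.
  (* Two points of a box are each within [k.+1%:R^-1] of its centre, so half of [e] bounds that
     radius. *)
  have e20 : 0 < e / 2 by rewrite divr_gt0.
  have [k _ /(_ k (leqnn _)) /= ke] := near_infty_natSinv_lt (PosNum e20).
  have /choice[c cP] : forall i : 'I_n, exists c : rat, `|x ord0 i - ratr c| < k.+1%:R^-1.
    move=> i; have [|c] := @rat_in_itvoo R (x ord0 i) (x ord0 i + k.+1%:R^-1).
      by rewrite ltrDl invr_gt0.
    rewrite in_itv /= => /andP[c1 c2]; exists c; rewrite distrC gtr0_norm ?subr_gt0//.
    by rewrite ltrBlDl.
  exists (\row_i c i, k) => //.
  have bV : box (\row_i c i, k) `<=` V.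
    move=> z zb; apply: eV; apply: (@le_lt_trans _ _ (k.+1%:R^-1 + k.+1%:R^-1)).
      apply: rV_norm_le => [|i]; first by rewrite addr_ge0.
      have := zb i I; rewrite /= mxE => zi; rewrite !mxE.
      rewrite (_ : _ - _ = (x ord0 i - ratr (c i)) - (z ord0 i - ratr (c i))); last by ring.
      by rewrite (le_trans (ler_normB _ _))// lerD// ltW.
    by rewrite [ltRHS]splitr ltrD.
  rewrite ifT; last exact/asboolP.
  by move=> i _ /=; rewrite mxE; exact: cP.
rewrite preimage_bigcup; apply: countable_bigcupT_measurable => [|ck].
  exact: countableP.
case: ifP => _; first exact: mbox.
by rewrite preimage_set0.
Qed.

Lemma measurable_continuous_rV (U : set 'rV[R]_n) (h : 'rV[R]_n -> R) : open U ->
  {in U, continuous h} -> measurable_fun (@to_rV R n @^-1` U) (fun p => h (to_rV p)).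
Proof.
move=> oU /(continuous_inP _ oU) ch.
apply: (measurability _ (RGenOpens.measurableE R)) => _ [_ [a [b ->]] <-].
have -> : (to_rV (n:=n) @^-1` U `&` (fun p => h (to_rV p)) @^-1` `]a, b[) =
  to_rV (n:=n) @^-1` (U `&` h @^-1` `]a, b[) by [].
by apply: measurable_open_rV; apply: ch; exact: itv_open.
Qed.

Lemma measurable_enorm : Borel (@enorm R n : _ -> measurableTypeR R).
Proof.
rewrite /Borel /enorm.
apply: (@measurableT_comp _ _ _ _ _ _ (@Num.sqrt R)).
  by apply: continuous_measurable_fun; exact: sqrt_continuous.
apply: measurable_sum => i; apply: measurable_funX; exact: measurable_coord.
Qed.

Lemma measurable_cball y r : measurable (@to_rV R n @^-1` cball_E y r).
Proof.
rewrite -[X in measurable X]setCK preimage_setC; apply: measurableC.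
apply: (@measurable_open_rV (~` cball_E y r)).
rewrite (_ : ~` _ = (fun x => enorm (x - y)) @^-1` [set z | r < z]); last first.
  by apply/seteqP; split => x /=; rewrite /cball_E/= ltNge => /negP.
apply: (@open_comp _ _ (fun x => enorm (x - y))); last exact: open_gt.
by move=> x _; exact: continuous_enormB.
Qed.
End euclid.

Section cube.
Context {R : realType}.

Definition cube n (c : R) : set (msp_T (lebRn R n)) := [set p | forall i, `|to_rV p ord0 i| <= c].

Lemma measurable_cube n c : measurable (@cube n c).
Proof.
rewrite (_ : cube c = \bigcap_(i in [set: 'I_n]) [set p | `|to_rV p ord0 i| <= c]); last first.
  by apply/seteqP; split => [p h i _|p h i]; [exact: h|exact: (h i I)].
apply: fin_bigcap_measurable => // i _.
rewrite -[X in measurable X]setTI.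
have -> : [set p | `|to_rV p ord0 i| <= c]
    = (fun p => to_rV p ord0 i) @^-1` `[-c, c].
  by apply/seteqP; split => p /=; rewrite in_itv/= ler_norml.
exact: (measurable_coord i).
Qed.

(** Cubes inside and around the ball give [0 < vol] and the finiteness of the volume. *)
Lemma cube_measure n (c : R) : 0 <= c -> msp_m (lebRn R n) (@cube n c) = ((2 * c) ^+ n)%:E.
Proof.
move=> c0; elim: n => [|n IH].
  rewrite (_ : cube c = setT); last by apply/seteqP; split => // p _ [].
  by rewrite /= diracT expr0.
rewrite (_ : cube c = (`[-c, c] `*` @cube n c : set (msp_T (lebRn R n.+1)))); last first.
  apply/seteqP; split => -[a q]; rewrite /cube /=.
    move=> h; split.
      by have := h ord0; rewrite to_rV_consv consv0 in_itv/= ler_norml.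
    by move=> i; have := h (lift ord0 i); rewrite to_rV_consv consvS.
  move=> [ac h] i; rewrite to_rV_consv.
  case: (unliftP ord0 i) => [j|] ->; first by rewrite consvS.
  by rewrite consv0 ler_norml; rewrite in_itv/= in ac.
rewrite [LHS](@product_measure1E _ _ _ _ _ lebesgue_measure (msp_m (lebRn R n)))//; last first.
  exact: measurable_cube.
rewrite IH exprS EFinM; congr (_ * _)%E.
apply: (eq_trans (lebesgue_measure_itv `[-c, c])); rewrite /= lte_fin.
case: ltP => [_|cc]; first by congr EFin; rewrite opprK; ring.
have -> : c = 0 by apply/eqP; rewrite eq_le c0 andbT; move: cc; rewrite -subr_ge0; lra.
by rewrite mulr0.
Qed.
End cube.

Section measurable_inverse.
Context {R : realType}.
(** Inversion is continuous away from 0; the convention [0^-1 = 0] is split off as a separate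
    case. *)
Lemma measurable_invr : measurable_fun [set: R] (fun x : R => x^-1).
Proof.
rewrite (_ : (fun x : R => x^-1) = (fun x => if x == 0 then 0 else x^-1)); last first.
  by apply/funext => x; case: eqP => // ->; rewrite invr0.
apply: measurable_fun_if => //.
  exact: measurable_fun_eqr.
rewrite (_ : _ `&` _ = [set x : R | x != 0]); last first.
  by apply/seteqP; split => x /=; [move=> [_ ->]|move=> /negbTE ->].
apply: open_continuous_measurable_fun; first exact: open_neq.
by move=> x; rewrite inE /= => x0; exact: inv_continuous.
Qed.
End measurable_inverse.

(** * The integral of the radial weight *)

Section radial.
Context {R : realType} {n : nat}.
Local Open Scope ereal_scope.
Implicit Types phi psi : R -> R.

Definition Irad phi : \bar R := intRn (fun x : 'rV[R]_n => (phi (enorm x))%:E).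

Lemma Borel_rad phi : measurable_fun setT phi -> Borel (fun x : 'rV[R]_n => (phi (enorm x))%:E).
Proof.
move=> mphi; apply/measurable_EFinP.
by apply: (measurableT_comp mphi); exact: measurable_enorm.
Qed.

Lemma Irad_ge0 phi : (forall s, 0 <= phi s)%R -> 0 <= Irad phi.
Proof. by move=> h; apply: intRn_ge0 => v; rewrite lee_fin. Qed.

Lemma IradD phi psi : measurable_fun setT phi -> measurable_fun setT psi ->
  (forall s, 0 <= phi s)%R -> (forall s, 0 <= psi s)%R ->
  Irad (fun s => phi s + psi s)%R = Irad phi + Irad psi.
Proof.
move=> m1 m2 p1 p2; rewrite /Irad /intRn; under eq_integral do rewrite EFinD.
by rewrite ge0_integralD// => *; rewrite ?lee_fin//; exact: Borel_rad.
Qed.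

Lemma IradZ (c : R) phi : measurable_fun setT phi -> (forall s, 0 <= phi s)%R -> (0 <= c)%R ->
  Irad (fun s => c * phi s)%R = c%:E * Irad phi.
Proof.
move=> m1 p1 c0; rewrite /Irad /intRn; under eq_integral do rewrite EFinM.
by rewrite ge0_integralZl// => *; rewrite ?lee_fin//; exact: Borel_rad.
Qed.

Lemma le_Irad phi psi : measurable_fun setT phi -> measurable_fun setT psi ->
  (forall s, 0 <= phi s)%R -> (forall s, 0 <= psi s)%R ->
  (forall s, (0 <= s)%R -> (phi s <= psi s)%R) -> Irad phi <= Irad psi.
Proof.
move=> m1 m2 p1 p2 h; apply: ge0_le_integral => //.
- by move=> *; rewrite ?lee_fin.
- exact: Borel_rad.
- exact: Borel_rad.
- by move=> *; rewrite ?lee_fin h// enorm_ge0.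
Qed.

Lemma eq_Irad phi psi : (forall s, (0 <= s)%R -> phi s = psi s) -> Irad phi = Irad psi.
Proof. by move=> h; apply: eq_integral => p _; rewrite h// enorm_ge0. Qed.

Lemma Irad_scale (q : R) phi : (0 < q)%R -> measurable_fun setT phi -> (forall s, 0 <= phi s)%R ->
  Irad phi = (q ^+ n)%:E * Irad (fun s => phi (q * s)%R).
Proof.
move=> q0 m1 p1; rewrite /Irad (@intRn_affine _ _ 0%R q)//; last first.
- by move=> v; rewrite lee_fin.
- exact: Borel_rad.
by congr (_ * intRn _); apply/funext => v; rewrite add0r enormZ gtr0_norm.
Qed.

(** Radial profile of the weight on an annulus. Half-open annuli split without overlap, and [a = 0]
    removes only the origin from the ball. *)
Definition wt (a b s : R) : R := if (a < s)%R && (s <= b)%R then ((s ^+ n.-1)^-1)%R else 0%R.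
Definition ann (a b s : R) : R := if (a < s)%R && (s <= b)%R then 1%R else 0%R.
Definition bal (b s : R) : R := if (s <= b)%R then 1%R else 0%R.

Lemma measurable_wt a b : measurable_fun setT (wt a b).
Proof.
apply: measurable_fun_ifT => //.
  by apply: measurable_and; [exact: measurable_fun_ltr|exact: measurable_fun_ler].
apply: (measurableT_comp measurable_invr); exact: measurable_funX.
Qed.

Lemma measurable_ann a b : measurable_fun setT (ann a b).
Proof.
apply: measurable_fun_ifT => //.
by apply: measurable_and; [exact: measurable_fun_ltr|exact: measurable_fun_ler].
Qed.

Lemma measurable_bal b : measurable_fun setT (bal b).
Proof. by apply: measurable_fun_ifT => //; exact: measurable_fun_ler. Qed.

Lemma ann_ge0 a b s : (0 <= ann a b s)%R.
Proof. by rewrite /ann; case: ifP. Qed.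

Lemma bal_ge0 b s : (0 <= bal b s)%R.
Proof. by rewrite /bal; case: ifP. Qed.

Definition vol := fine (@lebesgue_Rn R n (cball_E 0%R 1%R)).

Lemma cball_fin (r : R) : (0 <= r)%R -> @lebesgue_Rn R n (cball_E 0%R r) < +oo.
Proof.
move=> r0; apply: (@le_lt_trans _ _ (msp_m (lebRn R n) (@cube R n r))).
  apply: le_measure; rewrite ?inE; [exact: measurable_cball|exact: measurable_cube|].
  move=> p /= pr i; rewrite /cball_E/= subr0 in pr.
  exact: le_trans (ler_coord_enorm _ _) pr.
by rewrite cube_measure// ltry.
Qed.

Lemma vol_gt0 : (0 < n)%N -> (0 < vol)%R.
Proof.
move=> n0; rewrite /vol fine_gt0//; apply/andP; split; last exact: cball_fin.
have c0 : (0 < n%:R^-1 :> R)%R by rewrite invr_gt0 ltr0n.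
apply: (@lt_le_trans _ _ (msp_m (lebRn R n) (@cube R n (n%:R^-1)%R))).
  by rewrite cube_measure ?ltW// lte_fin exprn_gt0// mulr_gt0.
apply: le_measure; rewrite ?inE; [exact: measurable_cube|exact: measurable_cball|].
move=> p /= pc; rewrite /cball_E/= subr0.
apply: (le_trans (enorm_le (ltW c0) pc)).
by rewrite divff// pnatr_eq0 -lt0n.
Qed.

Lemma Irad_bal1 : Irad (bal 1) = vol%:E.
Proof.
rewrite /vol fineK; last first.
  by rewrite ge0_fin_numE ?cball_fin// measure_ge0.
rewrite /Irad /intRn /lebesgue_Rn -[X in _ = _ X]setIT -integral_indic//; last exact: measurable_cball.
apply: eq_integral => p _; rewrite /bal indicE; congr (_%:E).
rewrite mem_cball subr0.
by case: ifP.
Qed.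

Lemma Irad_bal (q : R) : (0 < q)%R -> Irad (bal q) = (q ^+ n * vol)%:E.
Proof.
move=> q0; rewrite (Irad_scale q0); [|exact: measurable_bal|exact: bal_ge0].
rewrite EFinM -Irad_bal1; congr (_ * _); apply: eq_Irad => s s0.
by rewrite /bal -{2}(mulr1 q) ler_pM2l.
Qed.

Lemma wt_ge0 a b s : (0 <= a)%R -> (0 <= wt a b s)%R.
Proof.
move=> a0; rewrite /wt; case: ifP => // /andP[as_ _].
by rewrite invr_ge0 exprn_ge0// ltW// (le_lt_trans a0).
Qed.

(** The measure scales by [q ^+ n] and the weight by the inverse of [q ^+ n.-1], so a single [q]
    remains. *)
Lemma Irad_wt_scale (q a b : R) : (0 < n)%N -> (0 < q)%R -> (0 <= a)%R ->
  Irad (wt (q * a) (q * b)) = q%:E * Irad (wt a b).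
Proof.
move=> n0 q0 a0; have qa0 : (0 <= q * a)%R by rewrite mulr_ge0// ltW.
rewrite (Irad_scale q0); [|exact: measurable_wt|by move=> s; exact: wt_ge0].
have -> : Irad (fun s => wt (q * a) (q * b) (q * s)%R) = Irad (fun s => (q ^+ n.-1)^-1 * wt a b s)%R.
  apply: eq_Irad => s s0; rewrite /wt ltr_pM2l// ler_pM2l//.
  by case: ifP => _; rewrite ?mulr0// exprMn invfM.
rewrite IradZ; [|exact: measurable_wt|by move=> s; exact: wt_ge0|by rewrite invr_ge0 exprn_ge0// ltW].
rewrite muleA -EFinM; congr (_%:E * _).
by rewrite -(prednK n0) exprS /= mulfK// expf_neq0// gt_eqF.
Qed.

Lemma Irad_wt_split (a b c : R) : (0 <= a)%R -> (a <= b)%R -> (b <= c)%R ->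
  Irad (wt a c) = Irad (wt a b) + Irad (wt b c).
Proof.
move=> a0 ab bc; have b0 := le_trans a0 ab.
rewrite -IradD; [|exact: measurable_wt..|by move=> s; exact: wt_ge0|by move=> s; exact: wt_ge0].
apply: eq_Irad => s _; rewrite /wt.
have [sb|bs] := leP s b.
  by rewrite (le_trans sb bc) !andbT addr0.
by rewrite (le_lt_trans ab bs) andbF add0r.
Qed.

Lemma Irad_ann (q : R) : (0 < q <= 1)%R -> Irad (ann q 1) = ((1 - q ^+ n) * vol)%:E.
Proof.
move=> /andP[q0 q1].
have : Irad (bal 1) = Irad (bal q) + Irad (ann q 1).
  rewrite -IradD; [|exact: measurable_bal|exact: measurable_ann|exact: bal_ge0|exact: ann_ge0].
  apply: eq_Irad => s _; rewrite /bal /ann.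
  by have [sq|qs] := leP s q; rewrite ?(le_trans sq q1) ?addr0 ?add0r.
rewrite Irad_bal1 Irad_bal// mulrBl mul1r EFinB => ->.
by rewrite addeAC subee// add0e.
Qed.

Lemma Irad_wt_ann (q : R) : (0 < q <= 1)%R ->
  Irad (ann q 1) <= Irad (wt q 1) <= ((q ^+ n.-1)^-1)%:E * Irad (ann q 1).
Proof.
move=> /andP[q0 q1]; have q0' := ltW q0.
have qn : (0 <= (q ^+ n.-1)^-1)%R by rewrite invr_ge0 exprn_ge0.
rewrite -IradZ//; [|exact: measurable_ann|exact: ann_ge0].
apply/andP; split; apply: le_Irad.
- exact: measurable_ann.
- exact: measurable_wt.
- exact: ann_ge0.
- by move=> s; exact: wt_ge0.
- move=> s s0; rewrite /ann /wt; case: ifP => // /andP[qs s1].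
  by rewrite invf_ge1 ?exprn_ile1// exprn_gt0// (lt_trans q0).
- exact: measurable_wt.
- by apply: measurable_funM => //; exact: measurable_ann.
- by move=> s; exact: wt_ge0.
- by move=> s; rewrite mulr_ge0// ann_ge0.
- move=> s s0; rewrite /ann /wt; case: ifP => [/andP[qs s1]|]; last by rewrite mulr0.
  rewrite mulr1 lef_pV2 ?posrE ?exprn_gt0//; last exact: lt_trans qs.
  by rewrite lerXn2r ?nnegrE// ltW.
Qed.

(* The dyadic truncations satisfy [I_(m+1) = W + I_m / 2], with [W] the integral over the outermost
   annulus. *)
Lemma Irad_wt_pow2 (m : nat) : (0 < n)%N ->
  Irad (wt (2^-1 ^+ m) 1) <= 2%:E * Irad (wt 2^-1 1).
Proof.
move=> n0; have h0 : (0 < 2^-1 :> R)%R by rewrite invr_gt0.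
have h1 : (2^-1 <= 1 :> R)%R by rewrite invf_le1// ler1n.
have W0 : 0 <= Irad (wt 2^-1 1) by apply: Irad_ge0 => s; exact/wt_ge0/ltW.
elim: m => [|m IH].
  rewrite expr0 (_ : Irad _ = 0) ?mule_ge0//.
  rewrite /Irad /intRn; apply: integral0_eq => p _; rewrite /wt ltNge.
  by case: (_ <= 1)%R.
rewrite (@Irad_wt_split _ 2^-1%R); last 3 first.
- by rewrite exprn_ge0// ltW.
- by rewrite exprS ger_pMr// exprn_ile1// ltW.
- by [].
have -> : Irad (wt (2^-1 ^+ m.+1) 2^-1) = (2^-1)%:E * Irad (wt (2^-1 ^+ m) 1).
  by rewrite -Irad_wt_scale ?exprn_ge0 ?mulr1 ?exprS// ltW.
(* The bound [2 W] is the fixed point of [I = W + I / 2]. *)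
rewrite [leRHS]mule_natl mule2n leeD2r//.
apply: (le_trans (lee_wpmul2l _ IH)); first by rewrite lee_fin ltW.
by rewrite muleA -EFinM mulVf// mul1e.
Qed.

(** Monotone convergence carries the uniform bound on the dyadic truncations to the whole weight;
    the bound is finite because the weight is bounded on the outermost annulus. *)
Lemma Irad_wt0_fin : (0 < n)%N -> Irad (wt 0 1) < +oo.
Proof.
move=> n0; have h0 : (0 < 2^-1 :> R)%R by rewrite invr_gt0.
have h1 : (2^-1 <= 1 :> R)%R by rewrite invf_le1// ler1n.
have pm m : (0 <= 2^-1 ^+ m :> R)%R by rewrite exprn_ge0// ltW.
apply: (@le_lt_trans _ _ (2%:E * Irad (wt 2^-1 1))); last first.
  rewrite lte_mul_pinfty//.
  have /andP[_ ] := @Irad_wt_ann 2^-1%R (introT andP (conj h0 h1)).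
  by move=> /le_lt_trans; apply; rewrite Irad_ann ?h0// -EFinM ltry.
pose g (m : nat) (p : msp_T (lebRn R n)) := (wt (2^-1 ^+ m) 1 (enorm (to_rV p)))%:E.
have gcvg p : g m p @[m --> \oo] --> (wt 0 1 (enorm (to_rV p)))%:E.
  (* At the origin all truncations and the limit vanish; elsewhere the sequence is eventually
     constant. *)
  rewrite /g /wt; have := enorm_ge0 (to_rV p); rewrite le_eqVlt => /orP[/eqP <-|s0].
    rewrite ltxx /=; under eq_fun do rewrite ltNge pm /=; exact: cvg_cst.
  rewrite s0 /=; apply: cvg_near_cst.
  have : (2^-1 ^+ m : R)%R @[m --> \oo] --> (0 : R)%R.
    by apply: cvg_expr; rewrite ger0_norm ?(ltW h0)// invf_lt1// ltr1n.
  move=> /cvgrPdist_lt/(_ _ s0).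
  apply: filterS => m; rewrite sub0r normrN ger0_norm// => ->.
  by [].
have gnd p : {homo g^~ p : m k / (m <= k)%N >-> m <= k}.
  move=> m k mk; rewrite /g lee_fin /wt.
  have le2 : (2^-1 ^+ k <= 2^-1 ^+ m :> R)%R by rewrite ler_wiXn2l// ltW.
  case: ifP => [/andP[ms ->]|_]; first by rewrite (le_lt_trans le2 ms).
  by case: ifP => // /andP[ks _]; rewrite invr_ge0 exprn_ge0// ltW// (le_lt_trans (pm k)).
have gm m : measurable_fun setT (g m) by exact: Borel_rad (measurable_wt _ _).
have g0 m p : setT p -> 0 <= g m p by move=> _; rewrite lee_fin wt_ge0.
have gcv := cvg_monotone_convergence (mu := msp_m (lebRn R n)) measurableT gm g0 (fun p _ => gnd p).
have -> : Irad (wt 0 1) = \int[msp_m (lebRn R n)]_p limn (g^~ p).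
  by apply: eq_integral => p _; apply/esym/cvg_lim => //; exact: gcvg.
rewrite -(cvg_lim _ gcv)//; apply: lime_le.
  by apply/cvg_ex; eexists; exact: gcv.
by apply: nearW => m; exact: Irad_wt_pow2.
Qed.

(* Write [I] for the integral of the weight.  By homogeneity the annulus [q < |x| <= 1]
   contributes [(1 - q) I], while the weight lies there between [1] and [q^(1-n)]; let [q -> 1]. *)
Lemma Irad_wt0 : (0 < n)%N -> Irad (wt 0 1) = (n%:R * vol)%:E.
Proof.
move=> n0; have If := Irad_wt0_fin n0.
have I0 : 0 <= Irad (wt 0 1) by apply: Irad_ge0 => s; exact: wt_ge0.
have IE : Irad (wt 0 1) = (fine (Irad (wt 0 1)))%:E by rewrite fineK// ge0_fin_numE.
move: IE; set I := fine _ => IE; rewrite IE; congr EFin.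
(* Dividing by [1 - q] turns [1 - q ^+ n] into a geometric sum, so both bounds are polynomial in [q]
   and pass to the limit 1, where the sum is [n]. *)
have key (q : R) : (0 < q < 1)%R ->
  (vol * \sum_(k < n) q ^+ k <= I /\ q ^+ n.-1 * I <= vol * \sum_(k < n) q ^+ k)%R.
  move=> /andP[q0 q1].
  have q01 : (0 < q <= 1)%R by rewrite q0 ltW.
  have Wq : Irad (wt q 1) = ((1 - q) * I)%:E.
    have := @Irad_wt_split 0%R q 1%R (lexx _) (ltW q0) (ltW q1).
    have := @Irad_wt_scale q 0%R 1%R n0 q0 (lexx _).
    rewrite mulr0 mulr1 => ->; rewrite IE -EFinM.
    by case: (Irad (wt q 1)) => [w||] //= [H]; congr EFin; lra.
  have := Irad_wt_ann q01; rewrite Wq Irad_ann// -EFinM !lee_fin.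
  have -> : (1 - q ^+ n = (1 - q) * \sum_(k < n) q ^+ k)%R.
    by rewrite -opprB subrX1 -mulNr opprB.
  rewrite -mulrA ler_pM2l ?subr_gt0// mulrCA ler_pM2l ?subr_gt0// => /andP[h1 h2].
  rewrite mulrC; split => //.
  by move: h2; rewrite ler_pdivlMl ?exprn_gt0.
have cS : (vol * \sum_(k < n) q ^+ k)%R @[q --> (1 : R)^'-] --> (vol * n%:R)%R.
  apply: cvgM; first exact: cvg_cst.
  rewrite [X in _ --> X](_ : _ = \sum_(k < n) 1 ^+ k)%R; last first.
    by under eq_bigr do rewrite expr1n; rewrite sumr_const card_ord.
  apply: cvg_sumr => k; apply: cvg_at_left_filter; exact: exprn_continuous.
have cI : (q ^+ n.-1 * I)%R @[q --> (1 : R)^'-] --> I.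
  rewrite [X in _ --> X](_ : I = 1 ^+ n.-1 * I)%R; last by rewrite expr1n mul1r.
  apply: cvgM; last exact: cvg_cst.
  by apply: cvg_at_left_filter; exact: exprn_continuous.
have n01 : \forall q \near (1 : R)^'-, (0 < q < 1)%R.
  near=> q; apply/andP; split; near: q; [exact: nbhs_left_gt|exact: nbhs_left_lt].
apply/eqP; rewrite eq_le mulrC; apply/andP; split.
  by apply: (ler_cvg_to cI cS); apply: filterS n01 => q /key[].
apply: (ler_cvg_to cS (cvg_cst I)); apply: filterS n01 => q /key[]//.
Unshelve. all: by end_near. Qed.

Lemma integral_weight : (0 < n)%N ->
  \int[msp_m (lebRn R n)]_(p in @to_rV R n @^-1` cball_E 0%R 1%R)
    ((enorm (to_rV p) ^+ n.-1)^-1)%:E = (n%:R * vol)%:E.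
Proof.
move=> n0; rewrite integral_mkcond.
(* For [n = 1] the integrand is 1 even at the origin, where [wt 0 1] is 0, so the volume is used
   directly. *)
have [n1|n1] := eqVneq n 1%N.
  have n10 : n.-1 = 0%N by rewrite n1.
  have nR : n%:R = 1%R :> R by rewrite n1.
  transitivity (Irad (bal 1)); last by rewrite Irad_bal1 nR mul1r.
  apply: eq_integral => p _; rewrite /patch /bal n10 expr0 invr1.
  rewrite mem_cball subr0.
  by case: ifP.
rewrite -Irad_wt0//; apply: eq_integral => p _; rewrite /patch /wt.
rewrite mem_cball subr0.
have := enorm_ge0 (to_rV p); rewrite le_eqVlt => /orP[/eqP <-|->]; last by case: ifP.
(* at the origin the integrand is [0^-1 = 0] *)
rewrite ltxx /= ler01 expr0n (_ : (n.-1 == 0%N) = false) ?invr0//.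
by case: (n) n0 n1 => // -[].
Qed.
End radial.

Lemma is_derive_affine (R : realType) (c d s : R) : is_derive s 1 (fun s => c + d * s) d.
Proof.
have := is_deriveD (is_derive_cst c s 1) (is_deriveZ d (is_derive_id s 1)).
by rewrite add0r /GRing.scale /= mulr1.
Qed.

Lemma is_derive_trig (R : realType) (c a b s : R) :
  is_derive s 1 (fun s => c + a * cos s + b * sin s) (- a * sin s + b * cos s).
Proof.
have := is_deriveD (is_deriveD (is_derive_cst c s 1) (is_deriveZ a (is_derive_cos s)))
  (is_deriveZ b (is_derive_sin s)).
by rewrite add0r /GRing.scale /= mulrN mulNr.
Qed.

(** Integrability and the formula are proved together because additivity in the induction step needs
    the tail to be integrable. *)
Lemma Rintegral_lincomb (R : realType) d (X : measurableType d) (m : {measure set X -> \bar R})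
    (D : set X) (I : Type) (s : seq I) (P : pred I) (c : I -> R) (g : I -> X -> R) :
  measurable D -> (forall i, m.-integrable D (EFin \o g i)) ->
  m.-integrable D (EFin \o (fun x => \sum_(i <- s | P i) c i * g i x)) /\
  \int[m]_(x in D) (\sum_(i <- s | P i) c i * g i x) =
  \sum_(i <- s | P i) c i * \int[m]_(x in D) g i x.
Proof.
move=> mD ig; elim: s => [|i s [IH1 IH2]].
  rewrite big_nil; under eq_Rintegral do rewrite big_nil.
  split; last by rewrite /Rintegral integral0.
  rewrite (_ : EFin \o _ = cst 0%E); first exact: integrable0.
  by apply/funext => x; rewrite /= big_nil.
have icg : m.-integrable D (EFin \o (fun x => c i * g i x)).
  by rewrite /comp; under eq_fun do rewrite EFinM; apply: integrableZl => //; exact: ig.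
rewrite big_cons; under eq_Rintegral do rewrite big_cons.
rewrite (_ : (fun x => \sum_(j <- i :: s | P j) _) = (fun x => if P i then c i * g i x +
    \sum_(j <- s | P j) c j * g j x else \sum_(j <- s | P j) c j * g j x)); last first.
  by apply/funext => x; rewrite big_cons.
case: ifP => // _; split; last by rewrite RintegralD// IH2 RintegralZl.
by rewrite /comp; under eq_fun do rewrite EFinD; exact: integrableD.
Qed.

Lemma continuous_on_line (R : realType) (V : normedModType R) (h : V -> R) (c : R -> R) (y x : V) s :
  {for s, continuous c} -> {for y + c s *: x, continuous h} ->
  {for s, continuous (fun s => h (y + c s *: x))}.
Proof.
move=> cc ch; apply: (@continuous_comp _ _ _ (fun s => y + c s *: x) h) => //.
by apply: cvgD; [exact: cvg_cst|exact: cvgZr_tmp].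
Qed.

(** * Differentiating weighted integrals over the unit ball *)

Section weighted.
Context {R : realType} {n : nat}.
Hypothesis n0 : (0 < n)%N.
Variables (U : set 'rV[R]_n) (y : 'rV[R]_n) (r : R).
Hypotheses (oU : open U) (r0 : 0 < r) (yU : cball_E y r `<=` U).
Local Notation T := (msp_T (lebRn R n)).
Local Notation mu := (msp_m (lebRn R n)).
Local Notation B := (@to_rV R n @^-1` cball_E (0 : 'rV[R]_n) 1).

Definition weight (x : 'rV[R]_n) : R := (enorm x ^+ n.-1)^-1.

Lemma unit_ballE p : B p = (enorm (to_rV p) <= 1).
Proof. by rewrite /cball_E /= subr0. Qed.

Lemma weight_ge0 x : 0 <= weight x.
Proof. by rewrite invr_ge0 exprn_ge0// enorm_ge0. Qed.

Lemma measurable_weight : measurable_fun [set: T] (fun p => weight (to_rV p)).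
Proof.
apply: (measurableT_comp measurable_invr); apply: measurable_funX; exact: measurable_enorm.
Qed.

Lemma integrable_weight : mu.-integrable B (fun p => (weight (to_rV p))%:E).
Proof.
apply/integrableP; split.
  by apply/measurable_EFinP; apply: measurable_funTS; exact: measurable_weight.
under eq_integral do rewrite gee0_abs ?lee_fin ?weight_ge0//.
by rewrite integral_weight// ltry.
Qed.

Lemma Rintegral_weight : \int[mu]_(p in B) weight (to_rV p) = omega R n.
Proof. by rewrite /Rintegral integral_weight. Qed.

Lemma integrable_mul_weight (g : T -> R) (M : R) : measurable_fun B g ->
  (forall p, B p -> `|g p| <= M) -> mu.-integrable B (fun p => (g p * weight (to_rV p))%:E).
Proof.
move=> mg gM; have mB := @measurable_cball R n 0 1.
apply: (@le_integrable _ _ _ mu _ mB _ (fun p => (M * weight (to_rV p))%:E)).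
- apply/measurable_EFinP; apply: measurable_funM => //.
  by apply: measurable_funTS; exact: measurable_weight.
- move=> p Bp; rewrite /= lee_fin !normrM ler_wpM2r// (le_trans (gM _ Bp))//.
  exact: ler_norm.
- under eq_fun do rewrite EFinM.
  exact: integrableZl integrable_weight.
Qed.

Lemma continuous_bounded (h : 'rV[R]_n -> R) : {in U, continuous h} ->
  exists2 M, 0 <= M & forall z, cball_E y r z -> `|h z| <= M.
Proof.
move=> ch.
have cw : {within cball_E y r, continuous h}.
  apply: (continuous_subspaceW yU); rewrite continuous_open_subspace//.
have [M [_ MP]] := compact_bounded (continuous_compact cw (@compact_cball R n y r)).
exists (`|M| + 1); first by rewrite addr_ge0.
move=> z zb; apply: (MP (`|M| + 1)); last by exists z.
by rewrite (le_lt_trans (ler_norm M))// ltrDl.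
Qed.

(** [h] is controlled only on [U]; replacing it by 0 off the closed ball gives a Borel function on
    the whole space with the same values along [psi]. *)
Lemma measurable_comp_ball (h : 'rV[R]_n -> R) (psi : T -> 'rV[R]_n) :
  {in U, continuous h} ->
  (forall i, measurable_fun setT (fun p => psi p ord0 i)) ->
  (forall p, B p -> cball_E y r (psi p)) -> measurable_fun B (fun p => h (psi p)).
Proof.
move=> ch mpsi psiB.
pose ht z := if enorm (z - y) <= r then h z else 0.
have mht : Borel (ht : _ -> measurableTypeR R).
  apply: measurable_fun_if => //.
    apply: measurable_fun_ler => //.
    apply: (Borel_comp measurable_enorm) => i.
    under eq_fun do rewrite mxE [X in _ + X]mxE.
    by apply: measurable_funD => //; exact: measurable_coord.
  rewrite setTI; apply: (measurable_funS _ _ (measurable_continuous_rV oU ch)).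
    exact: measurable_open_rV.
  by move=> p /= pr; exact: yU.
have : measurable_fun B (fun p => ht (psi p)).
  by apply: measurable_funTS; exact: (Borel_comp mht mpsi).
apply: eq_measurable_fun => p; rewrite inE => Bp.
by rewrite /ht (psiB _ Bp : is_true (_ <= _)).
Qed.

Lemma C1_in_continuous (h : 'rV[R]_n -> R) : C1 U h -> {in U, continuous h}.
Proof. by move=> hU x; rewrite inE => Ux; exact: C1_continuous oU hU Ux. Qed.

Lemma C1_in_continuous_partial (h : 'rV[R]_n -> R) k :
  C1 U h -> {in U, continuous ('D_(unit_vec R k) h)}.
Proof. by move=> hU; have := (hU k).2; rewrite continuous_open_subspace. Qed.

Lemma C1_partials_bounded (h : 'rV[R]_n -> R) : C1 U h ->
  exists2 M, 0 <= M & forall k z, cball_E y r z -> `|'D_(unit_vec R k) h z| <= M.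
Proof.
move=> hU.
have /choice[M MP] : forall k : 'I_n, exists M, 0 <= M /\
    forall z, cball_E y r z -> `|'D_(unit_vec R k) h z| <= M.
  by move=> k; have [M M0 MP] := continuous_bounded (C1_in_continuous_partial (k := k) hU); exists M.
exists (\sum_k M k); first by apply: sumr_ge0 => k _; have [] := MP k.
move=> k z zb; apply: (le_trans ((MP k).2 z zb)).
by rewrite (bigD1 k)//= lerDl sumr_ge0// => i _; have [] := MP i.
Qed.

(** Serves both dilations and rotations: [g s] moves the unit ball inside the closed ball with
    coordinate speeds at most [K], so a multiple of the integrable weight dominates the
    derivative. *)
Lemma is_derive_integral (h : 'rV[R]_n -> R) (g : R -> 'rV[R]_n -> 'rV[R]_n)
    (dg : R -> 'rV[R]_n -> 'I_n -> R) (a u v K : R) :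
  C1 U h -> a \in `]u, v[ ->
  (forall s x, s \in `]u, v[ -> enorm x <= 1 -> cball_E y r (g s x)) ->
  (forall s i, measurable_fun [set: T] (fun p => g s (to_rV p) ord0 i)) ->
  (forall s x k, s \in `]u, v[ -> enorm x <= 1 ->
    is_derive s 1 (fun s => g s x ord0 k) (dg s x k)) ->
  (forall s x k, s \in `]u, v[ -> enorm x <= 1 -> `|dg s x k| <= K) ->
  is_derive a 1 (fun s => \int[mu]_(p in B) (h (g s (to_rV p)) * weight (to_rV p)))
    (\int[mu]_(p in B) ((\sum_k dg a (to_rV p) k * 'D_(unit_vec R k) h (g a (to_rV p)))
       * weight (to_rV p))).
Proof.
move=> hU auv gB mg dgP dgK.
have mB := @measurable_cball R n 0 1.
have [M M0 MP] := continuous_bounded (C1_in_continuous hU).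
have [M' M'0 M'P] := C1_partials_bounded hU.
have dF s x : s \in `]u, v[ -> enorm x <= 1 ->
    is_derive s 1 (fun s => h (g s x) * weight x)
     ((\sum_k dg s x k * 'D_(unit_vec R k) h (g s x)) * weight x).
  move=> suv x1.
  have dh : is_derive s 1 (fun s => h (g s x)) (\sum_k dg s x k * 'D_(unit_vec R k) h (g s x)).
    by apply: (C1_chain oU hU) => [|k]; [exact/yU/gB|exact: dgP].
  rewrite (_ : (fun s => _) = (fun s => weight x * h (g s x))); last by apply/funext => ?; rewrite mulrC.
  rewrite mulrC; exact: is_deriveZ.
have inth s : `]u, v[%classic s -> mu.-integrable B (EFin \o (fun p => h (g s (to_rV p)) * weight (to_rV p))).
  move=> suv; apply: (@integrable_mul_weight _ M).
    apply: (measurable_comp_ball (C1_in_continuous hU)); first exact: mg.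
    by move=> p; rewrite unit_ballE; exact: gB.
  by move=> p; rewrite unit_ballE => p1; apply: MP; exact: gB.
have derf s p : `]u, v[%classic s -> B p -> derivable (fun s => h (g s (to_rV p)) * weight (to_rV p)) s 1.
  by rewrite unit_ballE => suv p1; have [] := dF s _ suv p1.
(* One term for each of the [n] coordinates, each a speed times a partial derivative bounded by
   [M']; [K] is not assumed nonnegative, hence its absolute value. *)
have nKM x : 0 <= (n%:R * (`|K| * M')) * weight x.
  by rewrite !mulr_ge0// weight_ge0.
have intG : mu.-integrable B (EFin \o (fun p => (n%:R * (`|K| * M')) * weight (to_rV p))).
  by rewrite /comp; under eq_fun do rewrite EFinM; exact: integrableZl integrable_weight.
have partE s p : s \in `]u, v[ -> enorm (to_rV p) <= 1 ->
    partial1of2 (fun s p => h (g s (to_rV p)) * weight (to_rV p)) s p =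
    (\sum_k dg s (to_rV p) k * 'D_(unit_vec R k) h (g s (to_rV p))) * weight (to_rV p).
  by move=> suv p1; rewrite partial1of2E; exact: (@derive_val _ _ _ _ _ _ _ (dF s _ suv p1)).
have Gub s p : `]u, v[%classic s -> B p ->
    `|partial1of2 (fun s p => h (g s (to_rV p)) * weight (to_rV p)) s p| <=
      (n%:R * (`|K| * M')) * weight (to_rV p).
  rewrite unit_ballE => suv p1; rewrite partE// normrM (ger0_norm (weight_ge0 _)) ler_wpM2r ?weight_ge0//.
  apply: (le_trans (ler_norm_sum _ _ _)).
  have -> : n%:R * (`|K| * M') = \sum_(k < n) (`|K| * M').
    by rewrite sumr_const card_ord mulr_natl.
  apply: ler_sum => k _; rewrite normrM ler_pM//; last exact/M'P/gB.
  by rewrite (le_trans (dgK _ _ _ suv p1))// ler_norm.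
apply: DeriveDef.
  exact: (@derivable_under_integral _ _ _ mu _ B mB a u v auv inth derf _ _ intG Gub).
rewrite -derive1E (@differentiation_under_integral _ _ _ mu _ B mB a u v auv inth derf _ _ intG Gub)//.
by apply: eq_Rintegral => p; rewrite inE unit_ballE => p1; exact: partE.
Qed.

Lemma cball_dilate t x : 0 <= t <= r -> enorm x <= 1 -> cball_E y r (y + t *: x).
Proof.
move=> /andP[t0 tr] x1; rewrite /cball_E /= addrAC subrr add0r enormZ ger0_norm//.
by rewrite (le_trans _ tr)// ler_piMr.
Qed.

Lemma is_derive_dilation (h : 'rV[R]_n -> R) (t : R) : C1 U h -> t \in `]0, r[ ->
  is_derive t 1 (fun s => \int[mu]_(p in B) (h (y + s *: to_rV p) * weight (to_rV p)))
    (\int[mu]_(p in B) ((\sum_k to_rV p ord0 k * 'D_(unit_vec R k) h (y + t *: to_rV p))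
       * weight (to_rV p))).
Proof.
move=> hU tr.
apply: (@is_derive_integral h (fun s x => y + s *: x) (fun s x k => x ord0 k) t 0 r 1 hU tr).
- move=> s x; rewrite in_itv /= => /andP[s0 sr] x1.
  by apply: cball_dilate => //; rewrite !ltW.
- by move=> s i; exact: measurable_coord_affine.
- move=> s x k _ _.
  rewrite (_ : (fun s => _) = (fun s : R => y ord0 k + x ord0 k * s)); last first.
    by apply/funext => ?; rewrite !mxE mulrC.
  exact: is_derive_affine.
- by move=> s x k _ x1; exact: le_trans (ler_coord_enorm _ _) x1.
Qed.

(** A rotation preserves the measure, the unit ball and the weight; extension by 0 off the ball
    makes the integrand a function on the whole space. *)
Lemma integral_rot (h : 'rV[R]_n -> R) (t : R) i j a : {in U, continuous h} -> 0 <= t <= r ->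
  i != j -> cos (a / 2) != 0 ->
  \int[mu]_(p in B) (h (y + t *: rotv i j a (to_rV p)) * weight (to_rV p)) =
  \int[mu]_(p in B) (h (y + t *: to_rV p) * weight (to_rV p)).
Proof.
move=> ch tr ij ca; congr fine.
pose g (z : 'rV[R]_n) : \bar R := ((if enorm z <= 1 then h (y + t *: z) * weight z else 0)%:E)%R.
have mg : Borel g.
  apply/measurable_EFinP; apply: measurable_fun_if => //.
    by apply: measurable_fun_ler => //; exact: measurable_enorm.
  rewrite setTI (_ : _ @^-1` _ = B); last by apply/seteqP; split => p /=; rewrite /cball_E /= subr0.
  apply: measurable_funM; last by apply: measurable_funTS; exact: measurable_weight.
  apply: (measurable_comp_ball ch) => [k|p].
    exact: measurable_coord_affine.
  by rewrite unit_ballE; exact: cball_dilate.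
rewrite integral_mkcond [RHS]integral_mkcond.
transitivity (intRn (fun v => g (rotv i j a v))).
  apply: eq_integral => p _; rewrite /patch /g enorm_rot// /weight enorm_rot//.
  rewrite mem_cball subr0.
  by case: ifP.
rewrite intRn_rot_signed//.
apply: eq_integral => p _; rewrite /patch /g.
rewrite mem_cball subr0.
by case: ifP.
Qed.

Lemma integrable_coord_partial (h : 'rV[R]_n -> R) (t : R) i j : C1 U h -> 0 <= t <= r ->
  mu.-integrable B (EFin \o (fun p : T =>
    to_rV p ord0 i * 'D_(unit_vec R j) h (y + t *: to_rV p) * weight (to_rV p))).
Proof.
move=> hU tr; have [M M0 MP] := C1_partials_bounded hU.
apply: (@integrable_mul_weight _ M) => [|p].
  apply: measurable_funM; first by apply: measurable_funTS; exact: measurable_coord.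
  apply: (measurable_comp_ball (C1_in_continuous_partial (k := j) hU)) => [k|p].
    exact: measurable_coord_affine.
  by rewrite unit_ballE; exact: cball_dilate.
rewrite unit_ballE => p1; rewrite normrM -[leRHS]mul1r ler_pM//.
  exact: le_trans (ler_coord_enorm _ _) p1.
by apply: MP; exact: cball_dilate.
Qed.

(** The integral of the rotated function is constant for angles near 0; its derivative at 0, taken
    under the integral sign, is [t] times the integral in question. *)
Lemma rotation_derivative (h : 'rV[R]_n -> R) (t : R) i j : C1 U h -> 0 < t <= r -> i != j ->
  \int[mu]_(p in B) ((to_rV p ord0 i * 'D_(unit_vec R j) h (y + t *: to_rV p)
     - to_rV p ord0 j * 'D_(unit_vec R i) h (y + t *: to_rV p)) * weight (to_rV p)) = 0.
Proof.
move=> hU /andP[t0 tr] ij; have ji : j != i by rewrite eq_sym.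
have tr' : 0 <= t <= r by rewrite ltW.
pose dg (s : R) (x : 'rV[R]_n) (k : 'I_n) : R :=
  t * ((- sin s * x ord0 i - cos s * x ord0 j) * (k == i)%:R
     + (cos s * x ord0 i - sin s * x ord0 j) * (k == j)%:R).
have s01 : (0 : R) \in `](-1), 1[ by rewrite in_itv /= ltrN10 ltr01.
have H : is_derive (0 : R) 1
    (fun s => \int[mu]_(p in B) (h (y + t *: rotv i j s (to_rV p)) * weight (to_rV p)))
    (\int[mu]_(p in B) ((\sum_k dg 0 (to_rV p) k * 'D_(unit_vec R k) h (y + t *: rotv i j 0 (to_rV p)))
       * weight (to_rV p))).
  (* In [r * 4], the 4 counts the products in [dg], each at most 1 in absolute value, and [r] bounds
     [t]. *)
  apply: (@is_derive_integral h (fun s x => y + t *: rotv i j s x) dg 0 (-1) 1 (r * 4) hU s01).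
  - by move=> s x _ x1; apply: cball_dilate => //; rewrite enorm_rot.
  - move=> s k; rewrite (_ : (fun p => _) = (fun p : T => y ord0 k + t * (to_rV p ord0 k
      + ((cos s - 1) * to_rV p ord0 i - sin s * to_rV p ord0 j) * (k == i)%:R
      + (sin s * to_rV p ord0 i + (cos s - 1) * to_rV p ord0 j) * (k == j)%:R))); last first.
      by apply/funext => p; rewrite !mxE.
    have mc l := @measurable_coord R n l.
    repeat first [exact: mc | exact: measurable_cst | apply: measurable_funD
      | apply: measurable_funN | apply: measurable_funM].
  - move=> s x k _ _.
    rewrite (_ : (fun s => _) = (fun s : R =>
      (y ord0 k + t * (x ord0 k - x ord0 i * (k == i)%:R - x ord0 j * (k == j)%:R))
      + (t * (x ord0 i * (k == i)%:R + x ord0 j * (k == j)%:R)) * cos s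
      + (t * (x ord0 i * (k == j)%:R - x ord0 j * (k == i)%:R)) * sin s)); last first.
      by apply/funext => u; rewrite !mxE /=; ring.
    rewrite (_ : dg s x k = - (t * (x ord0 i * (k == i)%:R + x ord0 j * (k == j)%:R)) * sin s
      + (t * (x ord0 i * (k == j)%:R - x ord0 j * (k == i)%:R)) * cos s); last first.
      by rewrite /dg; ring.
    exact: is_derive_trig.
  - move=> s x k _ x1; rewrite /dg normrM ler_pM//; first by rewrite gtr0_norm.
    have xl l : `|x ord0 l| <= 1 by exact: le_trans (ler_coord_enorm _ _) x1.
    have p1 (a b : R) : `|a| <= 1 -> `|b| <= 1 -> `|a * b| <= 1.
      by move=> a1 b1; rewrite normrM mulr_ile1.
    have d1 (b : bool) : `|b%:R : R| <= 1 by case: b; rewrite ?normr1 ?normr0.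
    rewrite !mulrBl.
    rewrite (_ : 4 = 1 + 1 + (1 + 1)); last by ring.
    apply: (le_trans (ler_normD _ _)); apply: lerD; apply: (le_trans (ler_normB _ _));
      apply: lerD; rewrite ?mulNr ?normrN; apply: (p1 _ _) => //; apply: (p1 _ _) => //;
      by rewrite ?sin_max ?cos_max.
have C : is_derive (0 : R) 1
    (fun s => \int[mu]_(p in B) (h (y + t *: rotv i j s (to_rV p)) * weight (to_rV p))) 0.
  apply: (near_eq_is_derive (f := cst (\int[mu]_(p in B) (h (y + t *: to_rV p) * weight (to_rV p))))).
    apply: (near0_norm_lt (d := 1)) => // s s1; rewrite (integral_rot (C1_in_continuous hU))//.
    (* For [|s| < 1] the half-angle stays inside the interval where cosine is positive, since [pi]
       is at least 2. *)
    rewrite gt_eqF// cos_gt0_pihalf//.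
    move: s1; rewrite ltr_norml => /andP[s1 s2]; have := @pi_ge2 R => pi2.
    by apply/andP; split; lra.
have := @derive_val _ _ _ _ _ _ _ H; rewrite (@derive_val _ _ _ _ _ _ _ C).
have rot0 x : rotv i j 0 x = x.
  by rewrite /rotv cos0 sin0 subrr !mul0r subrr addr0 !scale0r !addr0.
under eq_Rintegral do rewrite rot0.
have E (p : T) : \sum_k dg 0 (to_rV p) k * 'D_(unit_vec R k) h (y + t *: to_rV p) =
  t * (to_rV p ord0 i * 'D_(unit_vec R j) h (y + t *: to_rV p)
     - to_rV p ord0 j * 'D_(unit_vec R i) h (y + t *: to_rV p)).
  rewrite (bigD1 i)//= (bigD1 j)//= big1 ?addr0; last first.
    by move=> k /andP[ki kj]; rewrite /dg (negbTE ki) (negbTE kj) !mulr0 addr0 mulr0 mul0r.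
  by rewrite /dg !eqxx (negbTE ij) (negbTE ji) sin0 cos0 /=; ring.
under eq_Rintegral do rewrite E -mulrA.
rewrite RintegralZl//; last 2 first.
- exact: measurable_cball.
- rewrite /comp; under eq_fun do rewrite mulrBl EFinB.
  by apply: integrableB; [exact: measurable_cball|exact: integrable_coord_partial..].
by move=> /esym/eqP; rewrite mulf_eq0 (gt_eqF t0) /= => /eqP.
Qed.

Lemma rotation_symmetry (h : 'rV[R]_n -> R) (t : R) i j : C1 U h -> 0 < t <= r ->
  \int[mu]_(p in B) (to_rV p ord0 i * 'D_(unit_vec R j) h (y + t *: to_rV p) * weight (to_rV p)) =
  \int[mu]_(p in B) (to_rV p ord0 j * 'D_(unit_vec R i) h (y + t *: to_rV p) * weight (to_rV p)).
Proof.
move=> hU /[dup] tr /andP[t0 tr']; have [->//|ij] := eqVneq i j.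
have tr0 : 0 <= t <= r by rewrite ltW.
apply/eqP; rewrite -subr_eq0 -RintegralB//; last 3 first.
- exact: measurable_cball.
- exact: integrable_coord_partial.
- exact: integrable_coord_partial.
by under eq_Rintegral do rewrite -mulrBl; rewrite rotation_derivative.
Qed.

(** * The mean value property on the unit ball *)

Variable f : 'rV[R]_n -> Cl R n.
Hypothesis hol : left_clifford_holomorphic U f.

Lemma C1_component A : C1 U (fun z => f z A).
Proof. by move=> j; exact: (hol.1 A j). Qed.

(** The Euler derivative becomes a sum over ordered pairs of antisymmetric signs times integrals
    symmetric under exchange of [i] and [j]. *)
Lemma dilation_derivative A t : t \in `]0, r[ ->
  \int[mu]_(p in B) ((\sum_k to_rV p ord0 k *
     'D_(unit_vec R k) (fun z => f z A) (y + t *: to_rV p)) * weight (to_rV p)) = 0.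
Proof.
rewrite in_itv /= => /andP[t0 tr].
have t0r : 0 < t <= r by rewrite t0 ltW.
have t0r' : 0 <= t <= r by rewrite !ltW.
pose A2 (ij : 'I_n * 'I_n) := symdiff [set ij.2]%SET (symdiff [set ij.1]%SET A).
pose g ij (p : T) := to_rV p ord0 ij.1 * 'D_(unit_vec R ij.2) (fun z => f z (A2 ij)) (y + t *: to_rV p)
  * weight (to_rV p).
have E : \int[mu]_(p in B) ((\sum_k to_rV p ord0 k *
     'D_(unit_vec R k) (fun z => f z A) (y + t *: to_rV p)) * weight (to_rV p)) =
   \int[mu]_(p in B) (\sum_(ij | ij.2 != ij.1) - esign2 ij.1 ij.2 A * g ij p).
  apply: eq_Rintegral => p; rewrite inE unit_ballE => p1.
  have Up : U (y + t *: to_rV p) by apply: yU; exact: cball_dilate.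
  have := clifford_euler (to_rV p) A hol Up; rewrite /partial => ->.
  rewrite mulNr mulr_suml -sumrN.
  under eq_bigr do rewrite mulr_suml -sumrN.
  rewrite pair_big_dep /=; apply: eq_bigr => -[i j] _ /=.
  by rewrite /g /A2 /=; ring.
rewrite E.
have [|ij|_ ->] := @Rintegral_lincomb R _ _ mu B _ (index_enum _) (fun ij : 'I_n * 'I_n => ij.2 != ij.1)
   (fun ij => - esign2 ij.1 ij.2 A) g.
- exact: measurable_cball.
- exact: (integrable_coord_partial _ _ (C1_component _)).
set S := \sum_(_ | _) _.
(* Exchanging [i] and [j] keeps the component [A2], because the two symmetric differences
   commute. *)
have SN : S = - S.
  rewrite {1}/S (reindex_inj (h := fun ij : 'I_n * 'I_n => (ij.2, ij.1))) /=; last first.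
    by move=> [a b] [c d] [-> ->].
  rewrite /S -sumrN; apply: eq_big => [[i j]|[i j]] /=; first by rewrite eq_sym.
  move=> ij; rewrite (@esign2_anti _ _ i j)//.
  have -> : \int[mu]_(p in B) g (j, i) p = \int[mu]_(p in B) g (i, j) p.
    rewrite /g /A2 /= symdiff1C.
    exact: (rotation_symmetry _ _ (C1_component _)).
  by ring.
by apply/eqP; move: SN => /eqP; rewrite -addr_eq0 -mulr2n mulrn_eq0.
Qed.

Lemma mean_value_unit A :
  \int[mu]_(p in B) (f (y + r *: to_rV p) A * weight (to_rV p)) = f y A * omega R n.
Proof.
have hU := C1_component A; have ch := C1_in_continuous hU.
have mB := @measurable_cball R n 0 1.
have [M M0 MP] := continuous_bounded ch.
(* [f] is only controlled along [y + t x] for [0 <= t <= r], whereas continuity under the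
   integral sign is stated on open intervals. *)
pose clamp (t : R) : R := Num.max 0 (Num.min t r).
have clampP t : 0 <= clamp t <= r.
  by rewrite /clamp le_max lexx /= ge_max (ltW r0) /= ge_min lexx orbT.
have clampE t : 0 <= t <= r -> clamp t = t.
  by move=> /andP[t0 tr]; rewrite /clamp (min_idPl tr) (max_idPr t0).
have cclamp : continuous clamp.
  have -> : clamp = (cst 0 \max (id \min cst r)) by [].
  apply: (@max_fun_continuous _ R R); first exact: cst_continuous.
  by apply: min_fun_continuous; [by move=> ?; exact: cvg_id|exact: cst_continuous].
pose F t (p : T) := f (y + clamp t *: to_rV p) A * weight (to_rV p).
have intF t : mu.-integrable B (EFin \o F t).
  apply: (@integrable_mul_weight _ M) => [|p].
    apply: (measurable_comp_ball ch) => [k|p].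
      exact: measurable_coord_affine.
    by rewrite unit_ballE; exact: cball_dilate.
  by rewrite unit_ballE => p1; apply: MP; exact: cball_dilate.
pose Phi t := \int[mu]_(p in B) F t p.
have cPhi : {within `[0, r], continuous Phi}.
  apply: continuous_in_subspaceT => t; rewrite inE /= in_itv /= => /andP[t0 tr].
  (* The ends [-1] and [r + 1] merely provide an open interval containing [[0, r]]. *)
  apply: (@continuity_under_integral _ _ _ mu F B mB (-1) (r + 1) _ _
    (fun p => M * weight (to_rV p))).
  - by move=> s _; exact: intF.
  - apply: aeW => p; rewrite unit_ballE => p1 s _.
    apply: (@continuousM _ _ (fun s => f (y + clamp s *: to_rV p) A)
      (cst (weight (to_rV p))) s); last exact: cst_continuous.
    apply: (@continuous_on_line R 'rV[R]_n (fun z => f z A) clamp y (to_rV p) s (cclamp s)).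
    by apply: ch; rewrite inE; apply: yU; exact: cball_dilate.
  - by rewrite /comp; under eq_fun do rewrite EFinM; exact: integrableZl integrable_weight.
  - move=> s _; apply: aeW => p; rewrite unit_ballE => p1.
    rewrite /F normrM (ger0_norm (weight_ge0 _)) ler_wpM2r ?weight_ge0//.
    by apply: MP; exact: cball_dilate.
  - by rewrite inE /= in_itv /=; apply/andP; split; move: r0; lra.
have dPhi t : t \in `]0, r[ -> is_derive t 1 Phi 0.
  move=> tr; have := is_derive_dilation hU tr; rewrite dilation_derivative//.
  apply: near_eq_is_derive.
  have : \forall s \near t, s \in `]0, r[ by exact: near_in_itvoo.
  apply: filterS => s; rewrite in_itv /= => /andP[s0 sr].
  have s0r : 0 <= s <= r by rewrite !ltW.
  by apply: eq_Rintegral => p _; rewrite /F clampE.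
have [c _] := MVT_segment (ltW r0) dPhi cPhi.
rewrite mul0r => /eqP; rewrite subr_eq0 => /eqP.
have r0r : 0 <= r <= r by rewrite lexx ltW.
have z0r : 0 <= (0 : R) <= r by rewrite lexx ltW.
rewrite /Phi /F (clampE _ r0r) (clampE _ z0r) => ->.
under eq_Rintegral do rewrite scale0r addr0.
by rewrite RintegralZl ?Rintegral_weight//; exact: integrable_weight.
Qed.
End weighted.

(** * Return to the ball of radius [r] *)

Theorem theorem3 (R : realType) (n : nat) (U : set 'rV[R]_n)
    (f : 'rV[R]_n -> Cl R n) (y : 'rV[R]_n) (r : R) :
  (0 < n)%N ->
  domain U ->
  left_clifford_holomorphic U f ->
  0 < r ->
  cball_E y r `<=` U ->
  forall A : {set 'I_n},
    (f y A)%:E =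
    (((r * omega R n)^-1)%:E *
       lebesgue_int_Rn (cball_E y r) (fun x => (f x A / enorm (x - y) ^+ n.-1)%R))%E.
Proof.
move=> n0 [oU _] hol r0 yU A.
have hU : C1 U (fun z => f z A) by move=> j; exact: (hol.1 A j).
have ch := C1_in_continuous oU hU.
have om0 : omega R n != 0.
  by rewrite /omega mulf_neq0 ?pnatr_eq0 -?lt0n// gt_eqF//; exact: vol_gt0.
pose g (z : 'rV[R]_n) : R := if enorm (z - y) <= r then f z A / enorm (z - y) ^+ n.-1 else 0.
have mBorelD : Borel (fun z : 'rV[R]_n => enorm (z - y) : measurableTypeR R).
  apply: (Borel_comp measurable_enorm) => i.
  under eq_fun do rewrite mxE [X in _ + X]mxE.
  by apply: measurable_funD => //; exact: measurable_coord.
have mg : Borel (fun z => (g z)%:E).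
  apply/measurable_EFinP; apply: measurable_fun_if => //.
    exact: measurable_fun_ler.
  apply: measurable_funM; last first.
    apply: measurable_funTS; apply: (measurableT_comp measurable_invr).
    by apply: measurable_funX; exact: mBorelD.
  rewrite setTI; apply: (measurable_funS _ _ (measurable_continuous_rV oU ch)).
    exact: measurable_open_rV.
  by move=> p /= pr; exact: yU.
have [M M0 MP] := continuous_bounded oU yU ch.
(* Integrability makes the extended integral finite, so it agrees with the real-valued one in
   [mean_value_unit]. *)
have intF : (msp_m (lebRn R n)).-integrable (@to_rV R n @^-1` cball_E 0 1)
    (fun p => (f (y + r *: to_rV p) A * weight (to_rV p))%:E).
  apply: (@integrable_mul_weight _ _ n0 _ M) => [|p].
    apply: (measurable_comp_ball oU yU ch) => [k|p].
      exact: measurable_coord_affine.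
    by rewrite unit_ballE => p1; apply: cball_dilate => //; rewrite lexx ltW.
  by rewrite unit_ballE => p1; apply: MP; apply: cball_dilate => //; rewrite lexx ltW.
have -> : lebesgue_int_Rn (cball_E y r) (fun x => f x A / enorm (x - y) ^+ n.-1)
    = intRn (fun z => (g z)%:E).
  rewrite /lebesgue_int_Rn integral_mkcond; apply: eq_integral => p _.
  rewrite /patch /g mem_cball.
  by case: ifP.
rewrite (intRn_affine_signed y r0 mg).
(* Homogeneity of the norm extracts the inverse of [r ^+ n.-1]; against the Jacobian [r ^+ n] this
   leaves the single [r] of the normalisation. *)
have -> : intRn (fun v => (g (y + r *: v))%:E) = (((r ^+ n.-1)^-1)%:E * (f y A * omega R n)%:E)%E.
  rewrite -(mean_value_unit n0 oU r0 yU hol A) /Rintegral fineK; last first.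
    by apply: integrable_fin_num intF; exact: measurable_cball.
  rewrite -integralZl//; last exact: measurable_cball.
  rewrite [RHS]integral_mkcond; apply: eq_integral => p _; rewrite /patch /g.
  rewrite mem_cball subr0.
  rewrite addrAC subrr add0r enormZ gtr0_norm// -[X in _ <= X]mulr1 ler_pM2l//.
  case: ifP => // _; rewrite -EFinM /weight exprMn invfM; congr EFin.
  by rewrite mulrCA mulrA.
rewrite -!EFinM; congr EFin.
have rn : r ^+ n = r * r ^+ n.-1 by rewrite -exprS prednK.
rewrite rn; field.
by rewrite om0 expf_neq0 ?gt_eqF.
Qed.
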